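(* Let $N>1$ and $k\in\mathbb C$. Then $\chi_k^f$ and $\chi_k^e$ are the only characters of $\mathbb D_k$.
   Context: All vector spaces are complex and $\mathbb N=\{0,1,2,\dots\}$. $\mathfrak g=\mathfrak g^J_N$ (the complexified Lie algebra of the real Jacobi group of degree $1$ and rank $N$) is the Lie algebra with basis $E,F,H$; $e_r,f_r$ ($1\le r\le N$); $Z_{rs}$ ($1\le r\le s\le N$), with $Z_{sr}:=Z_{rs}$, and brackets: $[H,E]=2E$, $[H,F]=-2F$, $[E,F]=H$; $[H,e_r]=e_r$, $[H,f_r]=-f_r$, $[E,e_r]=0$, $[E,f_r]=-e_r$, $[F,e_r]=-f_r$, $[F,f_r]=0$; $[e_r,f_s]=-2Z_{rs}$, $[e_r,e_s]=[f_r,f_s]=0$; all $Z_{rs}$ central. The tilde basis is $\tilde H:=i(F-E)$, $\tilde E:=\tfrac12(H+i(F+E))$, $\tilde F:=\tfrac12(H-i(F+E))$, $\tilde Z_{rs}:=\tfrac12iZ_{rs}$, $\tilde e_r:=\tfrac12(f_r+ie_r)$, $\tilde f_r:=\tfrac12(f_r-ie_r)$; it satisfies the same bracket relations as the original basis. Put $\mathfrak k:=\mathrm{Span}\{\tilde H,\tilde Z_{rs}\}$. $\mathfrak U(\mathfrak g)^{\mathfrak k}$ is the commutant of $\mathfrak k$ in the universal enveloping algebra. For $k\in\mathbb C$, $\mathcal I_k$ is the left ideal of $\mathfrak U(\mathfrak g)$ generated by $\tilde H-k$ and all $\tilde Z_{rs}+\tfrac12\delta_{rs}$, and $\mathbb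 D_k:=\mathfrak U(\mathfrak g)^{\mathfrak k}/(\mathcal I_k\cap\mathfrak U(\mathfrak g)^{\mathfrak k})$ (the ideal is two-sided). (This is the algebra of invariant differential operators of the slash action with parameters $k$, $L=\frac1{2\pi}I_N$.) Equivalently, let $A$ be the quotient of $\mathfrak U(\mathfrak g)$ by the two-sided ideal generated by the $\tilde Z_{rs}+\tfrac12\delta_{rs}$, and let $A^{\tilde H}$ be the commutant of $\tilde H$ in $A$; then $\mathbb D_k=A^{\tilde H}/A^{\tilde H}(\tilde H-k)$. In $A$ set $\tilde E_\nu:=\tilde E+\tfrac12\sum_r\tilde e_r^2$ and $\tilde F_\nu:=\tilde F-\tfrac12\sum_r\tilde f_r^2$. Monomials in $\tilde E_\nu,\tilde F_\nu,\tilde e_r,\tilde f_r$ commuting with $\tilde H$ are regarded as elements of $\mathbb D_k$. For $I\in\mathbb N^N$, $\tilde f^I:=\prod_r\tilde f_r^{I_r}$, $\tilde e^I:=\prod_r\tilde e_r^{I_r}$, $|I|:=\sum_rI_r$. Let $\mathcal L_k^f$ (resp. $\mathcal L_k^e$) be the span in $\mathbb D_k$ of the elements $\tilde F_\nu^{i_F}\tilde f^{I_f}\tilde E_\nu^{i_E}\tilde e^{I_e}$ (resp. $\tilde E_\nu^{i_E}\tilde e^{I_e}\tilde F_\nu^{i_F}\tilde f^{I_f}$) with $i_F,i_E\in\mathbb N$, $I_f,I_e\in\mathbb N^N$, $2i_F+|I_f|=2i_E+|I_e|>0$. These are two-sided ideals of codimension $1$. A character of $\mathbb D_k$ is an algebra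 homomorphism from $\mathbb D_k$ onto $\mathbb C$; $\chi_k^f$ and $\chi_k^e$ are the characters with kernels $\mathcal L_k^f$ and $\mathcal L_k^e$, respectively. *)

(* Defs.v *)
From HB Require Import structures.
From mathcomp Require Import all_boot all_order all_algebra ring.
From mathcomp Require Import boolp classical_sets.
From mathcomp.multinomials Require Import monalg.

Set Implicit Arguments.
Unset Strict Implicit.
Unset Printing Implicit Defensive.

Import GRing.Theory Num.Theory.
Local Open Scope ring_scope.
Local Open Scope quotient_scope.
Local Open Scope classical_set_scope.

(* Finite combinations of elements of G, with coefficients on the left for
   [left_ideal] and on both sides for [ideal]. *)
Inductive span (K : pzRingType) (V : lmodType K) (G : set V) : set V :=
| Span0 : span G 0
| SpanD (c : K) (g v : V) : G g -> span G v -> span G (c *: g + v).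

Inductive left_ideal (A : pzRingType) (G : set A) : set A :=
| LIdeal0 : left_ideal G 0
| LIdealD (a g x : A) : G g -> left_ideal G x -> left_ideal G (a * g + x).

Inductive ideal (A : pzRingType) (G : set A) : set A :=
| Ideal0 : ideal G 0
| IdealD (a g b x : A) : G g -> ideal G x -> ideal G (a * g * b + x).

Section IdealTheory.
Variables (A : pzRingType) (G : set A).

Lemma left_idealD x y : left_ideal G x -> left_ideal G y -> left_ideal G (x + y).
Proof.
move=> + Iy; elim=> [|a g z Gg _ IH]; first by rewrite add0r.
by rewrite -addrA; apply: LIdealD.
Qed.

Lemma left_idealMl a x : left_ideal G x -> left_ideal G (a * x).
Proof.
elim=> [|b g z Gg _ IH]; first by rewrite mulr0; apply: LIdeal0.
by rewrite mulrDr mulrA; apply: LIdealD.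
Qed.

Lemma left_idealN x : left_ideal G x -> left_ideal G (- x).
Proof. by move=> Ix; rewrite -mulN1r; apply: left_idealMl. Qed.

Lemma left_idealMr_comm x y : (forall g, G g -> g * y = y * g) ->
  left_ideal G x -> left_ideal G (x * y).
Proof.
move=> cy; elim=> [|a g z Gg _ IH]; first by rewrite mul0r; apply: LIdeal0.
by rewrite mulrDl -mulrA cy // mulrA; apply: LIdealD.
Qed.

Lemma idealD x y : ideal G x -> ideal G y -> ideal G (x + y).
Proof.
move=> + Iy; elim=> [|a g b z Gg _ IH]; first by rewrite add0r.
by rewrite -addrA; apply: IdealD.
Qed.

Lemma idealMl a x : ideal G x -> ideal G (a * x).
Proof.
elim=> [|b g c z Gg _ IH]; first by rewrite mulr0; apply: Ideal0.
by rewrite mulrDr !mulrA; apply: IdealD.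
Qed.

Lemma idealMr a x : ideal G x -> ideal G (x * a).
Proof.
elim=> [|b g c z Gg _ IH]; first by rewrite mul0r; apply: Ideal0.
by rewrite mulrDl -mulrA; apply: IdealD.
Qed.

Lemma idealN x : ideal G x -> ideal G (- x).
Proof. by move=> Ix; rewrite -mulN1r; apply: idealMl. Qed.

Lemma ideal_gen x : G x -> ideal G x.
Proof.
move=> Gx; have := @IdealD A G 1 x 1 0 Gx (Ideal0 G).
by rewrite mul1r mulr1 addr0.
Qed.

End IdealTheory.

HB.mixin Record isTwoSided (A : pzRingType) (I : A -> bool) := {
  two_sidedMl : forall a x, I x -> I (a * x);
  two_sidedMr : forall a x, I x -> I (x * a)
}.

#[short(type="twoSidedIdeal")]
HB.structure Definition TwoSidedIdeal (A : pzRingType) :=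
  {I of GRing.ZmodClosed A I & isTwoSided A I}.

(* The additive quotient is the library's; here it receives its
   multiplication and its scalar action.  The quotient ring may be zero, hence
   [pzRingType]; the library's [algType] is for nonzero rings only. *)
Definition algquot (K : pzRingType) (A : algType K) (I : twoSidedIdeal A) : Type :=
  Quotient.quot I.

HB.instance Definition _ (K : pzRingType) (A : algType K) (I : twoSidedIdeal A) :=
  GRing.Zmodule.on (algquot I).

Definition aq_pi (K : pzRingType) (A : algType K) (I : twoSidedIdeal A) (x : A) :
  algquot I := \pi_(Quotient.quot I) x.
Definition aq_repr (K : pzRingType) (A : algType K) (I : twoSidedIdeal A)
  (u : algquot I) : A := repr (u : Quotient.quot I).

(* Locked, so that failing unifications in quotients stay cheap. *)
HB.lock Definition aq_mul (K : pzRingType) (A : algType K) (I : twoSidedIdeal A)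
  (u v : algquot I) : algquot I := aq_pi I (aq_repr u * aq_repr v).
HB.lock Definition aq_scale (K : pzRingType) (A : algType K) (I : twoSidedIdeal A)
  (c : K) (u : algquot I) : algquot I := aq_pi I (c *: aq_repr u).

Section AlgebraQuotient.
Variables (K : pzRingType) (A : algType K) (I : twoSidedIdeal A).

Local Notation algquot := (algquot I).
Local Notation aq_pi := (@aq_pi K A I).
Local Notation aq_repr := (@aq_repr K A I).
Local Notation aq_mul := (@aq_mul K A I).
Local Notation aq_scale := (@aq_scale K A I).

Lemma aq_reprK : cancel aq_repr aq_pi.
Proof. exact: reprK. Qed.

Lemma aq_piP x y : (aq_pi x = aq_pi y) <-> (x - y \in I).
Proof. by rewrite Quotient.idealrBE; split=> /eqP. Qed.

Lemma aq_piD : {morph aq_pi : x y / x + y}.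
Proof. by move=> x y; rewrite /Defs.aq_pi raddfD. Qed.

Definition aq_one : algquot := aq_pi 1.

Let reprI x : aq_repr (aq_pi x) - x \in I.
Proof. by apply/aq_piP; rewrite aq_reprK. Qed.

Lemma aq_piM x y : aq_pi (x * y) = aq_mul (aq_pi x) (aq_pi y).
Proof.
rewrite aq_mul.unlock; apply/esym/aq_piP.
set x' := aq_repr _; set y' := aq_repr _.
have -> : x' * y' - x * y = x' * (y' - y) + (x' - x) * y.
  by rewrite mulrBr mulrBl addrA subrK.
by apply: rpredD; [apply: two_sidedMl|apply: two_sidedMr]; apply: reprI.
Qed.

Lemma aq_piZ c x : aq_pi (c *: x) = aq_scale c (aq_pi x).
Proof.
rewrite aq_scale.unlock; apply/esym/aq_piP; rewrite -scalerBr -mulr_algl.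
by apply: two_sidedMl; apply: reprI.
Qed.

Let aqE := (aq_piD, aq_piM, aq_piZ).

Fact aq_mulA : associative aq_mul.
Proof. by move=> x y z; rewrite -[x]aq_reprK -[y]aq_reprK -[z]aq_reprK -!aqE mulrA. Qed.
Fact aq_mul1 : left_id aq_one aq_mul.
Proof. by move=> x; rewrite -[x]aq_reprK -!aqE mul1r. Qed.
Fact aq_mulr1 : right_id aq_one aq_mul.
Proof. by move=> x; rewrite -[x]aq_reprK -!aqE mulr1. Qed.
Fact aq_mulDl : left_distributive aq_mul +%R.
Proof. by move=> x y z; rewrite -[x]aq_reprK -[y]aq_reprK -[z]aq_reprK -!aqE mulrDl !aqE. Qed.
Fact aq_mulDr : right_distributive aq_mul +%R.
Proof. by move=> x y z; rewrite -[x]aq_reprK -[y]aq_reprK -[z]aq_reprK -!aqE mulrDr !aqE. Qed.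

HB.instance Definition _ := GRing.Zmodule_isPzRing.Build algquot
  aq_mulA aq_mul1 aq_mulr1 aq_mulDl aq_mulDr.

Fact aq_scaleA a b u : aq_scale a (aq_scale b u) = aq_scale (a * b) u.
Proof. by rewrite -[u]aq_reprK -!aqE scalerA. Qed.
Fact aq_scale1 : left_id 1 aq_scale.
Proof. by move=> u; rewrite -[u]aq_reprK -!aqE scale1r. Qed.
Fact aq_scaleDr : right_distributive aq_scale +%R.
Proof. by move=> a u v; rewrite -[u]aq_reprK -[v]aq_reprK -!aqE scalerDr !aqE. Qed.
Fact aq_scaleDl u : {morph aq_scale^~ u : a b / a + b}.
Proof. by move=> a b; rewrite -[u]aq_reprK -!aqE scalerDl !aqE. Qed.

HB.instance Definition _ := GRing.Zmodule_isLmodule.Build K algquot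
  aq_scaleA aq_scale1 aq_scaleDr aq_scaleDl.

Fact aq_pi_zmod : zmod_morphism aq_pi.
Proof. by move=> x y; rewrite /Defs.aq_pi raddfB. Qed.
HB.instance Definition _ := GRing.isZmodMorphism.Build A algquot aq_pi aq_pi_zmod.
Fact aq_pi_monoid : monoid_morphism aq_pi.
Proof. by split=> // x y; apply: aq_piM. Qed.
HB.instance Definition _ := GRing.isMonoidMorphism.Build A algquot aq_pi aq_pi_monoid.
HB.instance Definition _ := GRing.isScalable.Build K A algquot *:%R aq_pi aq_piZ.

Lemma aq_scalerAl c (u v : algquot) : c *: (u * v) = (c *: u) * v.
Proof.
by rewrite -[u]aq_reprK -[v]aq_reprK -rmorphM -!linearZ -rmorphM scalerAl.
Qed.

Lemma aq_scalerAr c (u v : algquot) : c *: (u * v) = u * (c *: v).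
Proof.
by rewrite -[u]aq_reprK -[v]aq_reprK -rmorphM -!linearZ -rmorphM scalerAr.
Qed.

End AlgebraQuotient.

Section GeneratedIdeal.
Variables (A : pzRingType) (G : set A).

Definition ideal_pred : {pred A} := fun x => `[< ideal G x >].

Fact ideal_pred_zmod : zmod_closed ideal_pred.
Proof.
split=> [|x y /asboolP Ix /asboolP Iy]; first by apply/asboolP/Ideal0.
by apply/asboolP/idealD => //; apply: idealN.
Qed.
HB.instance Definition _ := GRing.isZmodClosed.Build A ideal_pred ideal_pred_zmod.

Fact ideal_predMl a x : ideal_pred x -> ideal_pred (a * x).
Proof. by move=> /asboolP Ix; apply/asboolP/idealMl. Qed.
Fact ideal_predMr a x : ideal_pred x -> ideal_pred (x * a).
Proof. by move=> /asboolP Ix; apply/asboolP/idealMr. Qed.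
HB.instance Definition _ := isTwoSided.Build A ideal_pred ideal_predMl ideal_predMr.

End GeneratedIdeal.

Definition word (L : choiceType) : Type := seq L.

Section Word.
Variable L : choiceType.
HB.instance Definition _ := Choice.on (word L).

Fact word_unit (v w : word L) : v ++ w = [::] -> v = [::] /\ w = [::].
Proof. by case: v w => [|? ?] [|? ?]. Qed.
HB.instance Definition _ := Choice_isMonomialDef.Build (word L)
  (@catA L) (@cat0s L) (@cats0 L) word_unit.
End Word.

Section FreeAlgebra.
Variables (K : comNzRingType) (L : choiceType).

Definition free_algebra : Type := {malg K[word L]}.

HB.instance Definition _ := GRing.Lalgebra.on free_algebra.

Fact free_scalerAr c (x y : free_algebra) : c *: (x * y) = x * (c *: y).
Proof.
apply/malgP=> m; rewrite mcoeffZ mcoeffMr mulr_sumr.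
rewrite (mcoeffMrw m (finmap.fsubset_refl (msupp x)) (msuppZ_le c y)).
apply: eq_bigr => i _; rewrite mulr_sumr; apply: eq_bigr => j _.
by rewrite mcoeffZ mulrCA mulrnAr.
Qed.
HB.instance Definition _ :=
  GRing.LSemiAlgebra_isSemiAlgebra.Build K free_algebra free_scalerAr.

Definition free_gen (x : L) : free_algebra := mkmalgU ([:: x] : word L) 1.

End FreeAlgebra.

(* The tensor algebra of L modulo xy - yx = [x, y], as the free algebra on the
   set L modulo linearity of the generators and these relations. *)
Section Enveloping.
Variables (K : comNzRingType) (L : lmodType K) (br : L -> L -> L).

Let gen (x : L) : free_algebra K L := free_gen K x.

Inductive env_rel : set (free_algebra K L) :=
| EnvLinear (a : K) (x y : L) :
    env_rel (gen (a *: x + y) - (a *: gen x + gen y))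
| EnvBracket (x y : L) :
    env_rel (gen x * gen y - gen y * gen x - gen (br x y)).

Definition envelop : Type := algquot (ideal_pred env_rel).

HB.instance Definition _ := GRing.PzRing.on envelop.
HB.instance Definition _ := GRing.Lmodule.on envelop.

Let aug (x : free_algebra K L) : K := mcoeff ([::] : word L) x.

Fact envelop_nonzero : (1 : envelop) != 0.
Proof.
have aug0 x : ideal env_rel x -> aug x = 0.
  have augM u v : aug (u * v) = aug u * aug v.
    exact: (@mcoeff1g_is_multiplicative (word L) K).1.
  have augN u : aug (- u) = - aug u by apply: mcoeffN.
  have augD u v : aug (u + v) = aug u + aug v by apply: mcoeffD.
  have augZ c u : aug (c *: u) = c * aug u by apply: mcoeffZ.
  have augg y : aug (gen y) = 0 by rewrite /aug /gen mcoeffU.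
  elim=> [|a g b y Gg _ IH]; first by apply: mcoeff0.
  rewrite augD !augM IH addr0.
  by case: Gg => *; rewrite !(augD, augN, augM, augZ, augg) !(mulr0, mul0r, subr0, addr0).
apply/eqP => e10.
have /asboolP/aug0 : (1 - 0 : free_algebra K L) \in ideal_pred env_rel.
  by apply/aq_piP; rewrite [RHS]rmorph0; apply: e10.
rewrite subr0.
rewrite /aug => /eqP.
by rewrite mcoeff1 eqxx oner_eq0.
Qed.

HB.instance Definition _ := GRing.PzSemiRing_isNonZero.Build envelop envelop_nonzero.
HB.instance Definition _ := GRing.LSemiModule_isLSemiAlgebra.Build K envelop
  (@aq_scalerAl _ _ (ideal_pred env_rel)).
HB.instance Definition _ := GRing.LSemiAlgebra_isSemiAlgebra.Build K envelop
  (@aq_scalerAr _ _ (ideal_pred env_rel)).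

Definition env_in (x : L) : envelop := aq_pi (ideal_pred env_rel) (gen x).

Lemma env_in_is_linear : linear env_in.
Proof.
move=> a x y; rewrite -[RHS](linearP (aq_pi (ideal_pred env_rel))).
by apply/aq_piP/asboolP/ideal_gen/EnvLinear.
Qed.
HB.instance Definition _ := GRing.isLinear.Build K L envelop *:%R env_in env_in_is_linear.

Lemma env_in_bracket x y :
  env_in (br x y) = env_in x * env_in y - env_in y * env_in x.
Proof.
rewrite /env_in -!rmorphM -rmorphB; apply/esym.
by apply/aq_piP/asboolP/ideal_gen/EnvBracket.
Qed.

End Enveloping.

Section Commutant.
Variables (K : pzRingType) (A : algType K) (S : set A).

Definition commutant : {pred A} := fun x => `[< forall y, S y -> y * x = x * y >].

Lemma commutantP x : reflect (forall y, S y -> y * x = x * y) (x \in commutant).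
Proof. exact: asboolP. Qed.

Fact commutant_subalg : subalg_closed commutant.
Proof.
split=> [|a x z /commutantP Cx /commutantP Cz|x z /commutantP Cx /commutantP Cz];
    apply/commutantP=> y Sy.
- by rewrite mul1r mulr1.
- by rewrite mulrDr mulrDl -scalerAr -scalerAl Cx ?Cz.
- by rewrite mulrA Cx // -!mulrA Cz.
Qed.
HB.instance Definition _ := GRing.isSubalgClosed.Build K A commutant commutant_subalg.

Definition commutant_alg : Type := {x : A | x \in commutant}.

HB.instance Definition _ := SubType.on commutant_alg.
HB.instance Definition _ := [Choice of commutant_alg by <:].
HB.instance Definition _ := [SubChoice_isSubAlgebra of commutant_alg by <:].

Definition in_commutant (x : A) (Cx : x \in commutant) : commutant_alg :=
  exist (fun x => is_true (x \in commutant)) x Cx.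

End Commutant.

Section Weights.
Variables (K : comNzRingType) (A : algType K) (h : A) (S : set A).

(* [u] has weight [c] under [ad h] and commutes with [S]. *)
Definition weight (c : K) (u : A) : Prop :=
  h * u - u * h = c *: u /\ forall z, S z -> z * u = u * z.

Lemma weight0 c : weight c 0.
Proof. by split=> *; rewrite !(mulr0, mul0r) ?subrr ?scaler0. Qed.

Lemma weight1 : weight 0 1.
Proof. by split=> *; rewrite !(mulr1, mul1r) ?subrr ?scale0r. Qed.

Lemma weightM c d u v : weight c u -> weight d v -> weight (c + d) (u * v).
Proof.
move=> [hu zu] [hv zv]; split=> [|z Sz]; last by rewrite mulrA zu // -!mulrA zv.
rewrite scalerDl [c *: _]scalerAl -hu [d *: _]scalerAr -hv.
by rewrite mulrBl mulrBr !mulrA addrA subrK.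
Qed.

Lemma weightD c u v : weight c u -> weight c v -> weight c (u + v).
Proof.
move=> [hu zu] [hv zv]; split=> [|z Sz]; last by rewrite mulrDl mulrDr zu ?zv.
by rewrite scalerDr -hu -hv mulrDl mulrDr opprD addrACA.
Qed.

Lemma weightZ c a u : weight c u -> weight c (a *: u).
Proof.
move=> [hu zu]; split=> [|z Sz]; last by rewrite -scalerAr -scalerAl zu.
by rewrite -scalerAr -scalerAl -scalerBr hu !scalerA mulrC.
Qed.

Lemma weight_sum n c (F : 'I_n -> A) :
  (forall r, weight c (F r)) -> weight c (\sum_r F r).
Proof.
by move=> wF; elim/big_ind: _ => // [|u v]; [apply: weight0|apply: weightD].
Qed.

Lemma weightX c u n : weight c u -> weight (c *+ n) (u ^+ n).
Proof.
move=> wu; elim: n => [|n IH]; first exact: weight1.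
by rewrite exprS mulrS; apply: weightM.
Qed.

Lemma weight_prod n (c : 'I_n -> K) (F : 'I_n -> A) :
  (forall r, weight (c r) (F r)) -> weight (\sum_r c r) (\prod_r F r).
Proof.
move=> wF; elim/big_ind2: _ => // [|c1 u d1 v wu wv]; first exact: weight1.
exact: weightM.
Qed.

End Weights.

(* The index [BZ] ranges over the pairs (r, s) with r <= s. *)
Inductive jbasis (N : nat) : Type :=
| BE | BF | BH
| Be of 'I_N
| Bf of 'I_N
| BZ of {p : 'I_N * 'I_N | (p.1 <= p.2)%N}.

Arguments BE {N}.
Arguments BF {N}.
Arguments BH {N}.

Section JBasisFinite.
Variable N : nat.

Let code : Type := ('I_3 + ('I_N + 'I_N) + {p : 'I_N * 'I_N | (p.1 <= p.2)%N})%type.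

Definition jbasis_code (b : jbasis N) : code :=
  match b with
  | BE => inl (inl (inord 0))
  | BF => inl (inl (inord 1))
  | BH => inl (inl (inord 2))
  | Be r => inl (inr (inl r))
  | Bf r => inl (inr (inr r))
  | BZ p => inr p
  end.

Definition jbasis_decode (c : code) : jbasis N :=
  match c with
  | inl (inl i) => nth BE [:: BE; BF; BH] i
  | inl (inr (inl r)) => Be r
  | inl (inr (inr r)) => Bf r
  | inr p => BZ p
  end.

Fact jbasis_codeK : cancel jbasis_code jbasis_decode.
Proof. by case=> //=; rewrite inordK. Qed.

HB.instance Definition _ := Finite.copy (jbasis N) (can_type jbasis_codeK).

End JBasisFinite.

Definition jacobi (C : numClosedFieldType) (N : nat) : Type :=
  {ffun jbasis N -> C^o}.

HB.instance Definition _ C N := GRing.Lmodule.on (jacobi C N).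

(* Locked: comparing distinct basis vectors by computation is very slow. *)
HB.lock Definition jvec (C : numClosedFieldType) (N : nat) (b : jbasis N) :
  jacobi C N := [ffun c => (c == b)%:R].

Lemma jvecE (C : numClosedFieldType) (N : nat) (b c : jbasis N) :
  jvec C b c = (c == b)%:R.
Proof. by rewrite jvec.unlock ffunE. Qed.

Section Jacobi.
Variables (C : numClosedFieldType) (N : nat).

Local Notation jacobi := (jacobi C N).
Local Notation jvec := (@jvec C N).

Definition sort_pair (r s : 'I_N) : 'I_N * 'I_N :=
  if (r <= s)%N then (r, s) else (s, r).
Fact sort_pairP (r s : 'I_N) : ((sort_pair r s).1 <= (sort_pair r s).2)%N.
Proof. by rewrite /sort_pair; case: (leqP r s) => //= /ltnW. Qed.

Definition jE : jacobi := jvec BE.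
Definition jF : jacobi := jvec BF.
Definition jH : jacobi := jvec BH.
Definition je (r : 'I_N) : jacobi := jvec (Be r).
Definition jf (r : 'I_N) : jacobi := jvec (Bf r).
Definition jZ (r s : 'I_N) : jacobi := jvec (BZ (exist _ (sort_pair r s) (sort_pairP r s))).

(* Each unordered pair of basis vectors with a nonzero bracket occurs here in
   one order only; [jbracket] antisymmetrizes and extends bilinearly. *)
Definition jtable (a b : jbasis N) : jacobi :=
  match a, b with
  | BH, BE => 2 *: jE
  | BH, BF => - (2 *: jF)
  | BE, BF => jH
  | BH, Be r => je r
  | BH, Bf r => - jf r
  | BE, Bf r => - je r
  | BF, Be r => - jf r
  | Be r, Bf s => - (2 *: jZ r s)
  | _, _ => 0
  end.

Definition jbracket (x y : jacobi) : jacobi :=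
  \sum_(a : jbasis N) \sum_(b : jbasis N) (x a * y b) *: (jtable a b - jtable b a).

Lemma jbracketC x y : jbracket x y = - jbracket y x.
Proof.
rewrite /jbracket exchange_big -sumrN; apply: eq_bigr => b _.
by rewrite -sumrN; apply: eq_bigr => a _; rewrite -scalerN opprB mulrC.
Qed.

Lemma jbracket_linearl z : linear (jbracket^~ z).
Proof.
move=> c x y; rewrite /jbracket scaler_sumr -big_split; apply: eq_bigr => a _.
rewrite scaler_sumr -big_split; apply: eq_bigr => b _ /=.
by rewrite !ffunE mulrDl scalerDl scalerA mulrA.
Qed.

Lemma jbracketDl x y z : jbracket (x + y) z = jbracket x z + jbracket y z.
Proof. by have := jbracket_linearl z 1 x y; rewrite !scale1r. Qed.
Lemma jbracketNl x z : jbracket (- x) z = - jbracket x z.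
Proof.
apply/eqP; rewrite -addr_eq0 -jbracketDl addNr -(inj_eq (addrI (jbracket 0 z))).
by rewrite -jbracketDl !addr0.
Qed.
Lemma jbracketZl c x z : jbracket (c *: x) z = c *: jbracket x z.
Proof.
by have := jbracket_linearl z c x (- x); rewrite jbracketDl !jbracketNl => /addIr.
Qed.
Lemma jbracketDr x y z : jbracket x (y + z) = jbracket x y + jbracket x z.
Proof. by rewrite ![jbracket x _]jbracketC jbracketDl opprD. Qed.
Lemma jbracketZr c x z : jbracket x (c *: z) = c *: jbracket x z.
Proof. by rewrite ![jbracket x _]jbracketC jbracketZl scalerN. Qed.
Lemma jbracketNr x z : jbracket x (- z) = - jbracket x z.
Proof. by rewrite ![jbracket x _]jbracketC jbracketNl. Qed.

Lemma jbracket_vec a b : jbracket (jvec a) (jvec b) = jtable a b - jtable b a.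
Proof.
rewrite /jbracket (bigD1 a) //= (bigD1 b) //= !jvecE !eqxx mulr1 scale1r.
rewrite !big1 ?addr0 // => [c /negPf nca|c /negPf ncb].
  by rewrite big1 // => d _; rewrite !jvecE nca mul0r scale0r.
by rewrite !jvecE ncb mulr0 scale0r.
Qed.

(* The suffix t stands for the tilde basis, which satisfies the same bracket
   relations as the original one. *)
Definition jHt : jacobi := 'i *: (jF - jE).
Definition jEt : jacobi := 2^-1 *: (jH + 'i *: (jF + jE)).
Definition jFt : jacobi := 2^-1 *: (jH - 'i *: (jF + jE)).
Definition jZt (r s : 'I_N) : jacobi := (2^-1 * 'i) *: jZ r s.
Definition jet (r : 'I_N) : jacobi := 2^-1 *: (jf r + 'i *: je r).
Definition jft (r : 'I_N) : jacobi := 2^-1 *: (jf r - 'i *: je r).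

Definition jk : set jacobi :=
  span [set x | x = jHt \/ exists r s, x = jZt r s].

Definition jU : Type := envelop jbracket.
HB.instance Definition _ := GRing.Algebra.on jU.

Definition jin (x : jacobi) : jU := env_in jbracket x.

Definition jUk : Type := commutant_alg [set jin y | y in jk].
HB.instance Definition _ := GRing.Algebra.on jUk.

Definition jI (k : C) : set jU :=
  left_ideal [set u | u = jin jHt - k%:A
    \/ exists r s, u = jin (jZt r s) + (2^-1 * (r == s)%:R)%:A].

Fact jI_commutant (k : C) (u x : jU) :
  jI k u -> x \in commutant [set jin y | y in jk] -> jI k (u * x).
Proof.
move=> Iu /commutantP Cx; apply: left_idealMr_comm Iu => g.
have kin y : jk y -> jin y * x = x * jin y by move=> ky; apply: Cx; exists y.
have genk y : (y = jHt \/ exists r s, y = jZt r s) -> jk y.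
  by move=> Gy; rewrite -[y]addr0 -[y]scale1r; apply: SpanD => //; apply: Span0.
have algC (c : C) : c%:A * x = x * c%:A by rewrite mulr_algl mulr_algr.
case=> [->|[r [s ->]]].
  by rewrite mulrBl mulrBr algC kin //; apply: genk; left.
by rewrite mulrDl mulrDr algC kin //; apply: genk; right; exists r, s.
Qed.

(* The trace of [jI k] on [jUk]; a two-sided ideal there. *)
Definition jIk (k : C) : {pred jUk} := fun x => `[< jI k (val x) >].

Fact jIk_zmod (k : C) : zmod_closed (jIk k).
Proof.
split=> [|x y /asboolP Ix /asboolP Iy]; apply/asboolP.
  by rewrite raddf0; apply: LIdeal0.
by rewrite raddfB; apply: left_idealD => //; apply: left_idealN.
Qed.
HB.instance Definition _ (k : C) := GRing.isZmodClosed.Build jUk (jIk k) (jIk_zmod k).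

Fact jIkMl (k : C) (a x : jUk) : jIk k x -> jIk k (a * x).
Proof. by move=> /asboolP Ix; apply/asboolP; rewrite rmorphM; apply: left_idealMl. Qed.
Fact jIkMr (k : C) (a x : jUk) : jIk k x -> jIk k (x * a).
Proof.
by move=> /asboolP Ix; apply/asboolP; rewrite rmorphM; apply: jI_commutant (valP a).
Qed.
HB.instance Definition _ (k : C) := isTwoSided.Build jUk (jIk k) (@jIkMl k) (@jIkMr k).

Definition jD (k : C) : Type := algquot (jIk k).
HB.instance Definition _ (k : C) := GRing.PzRing.on (jD k).
HB.instance Definition _ (k : C) := GRing.Lmodule.on (jD k).

Definition jpi (k : C) (x : jUk) : jD k := aq_pi (jIk k) x.

Lemma jbracket_central (x : jacobi) p : jbracket x (jvec (BZ p)) = 0.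
Proof.
rewrite /jbracket big1 // => a _; rewrite big1 // => b _; rewrite jvecE.
have [->|] := eqVneq; last by rewrite mulr0 scale0r.
by case: a => *; rewrite subr0 scaler0.
Qed.

Let coordD (x y : jacobi) c : (x + y) c = x c + y c.
Proof. by rewrite ffunE. Qed.
Let coordN (x : jacobi) c : (- x) c = - x c.
Proof. by rewrite ffunE. Qed.
Let coordZ a (x : jacobi) c : (a *: x) c = a * x c.
Proof. by rewrite ffunE. Qed.
Let coord0 c : (0 : jacobi) c = 0.
Proof. by rewrite ffunE. Qed.
Let coordE := (coordD, coordN, coordZ, coord0).

Let sqri : 'i ^+ 2 = -1 :> C.
Proof. by rewrite sqrCi. Qed.

Let jHt_comb c x y : jbracket jHt (2^-1 *: (x + c *: y)) =
  'i *: (2^-1 *: ((jbracket jF x - jbracket jE x)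
                  + c *: (jbracket jF y - jbracket jE y))).
Proof.
rewrite jbracketZr jbracketDr jbracketZr.
rewrite /jHt !(jbracketZl, jbracketDl, jbracketNl).
rewrite [c *: ('i *: _)]scalerA [c * _]mulrC -[('i * c) *: _]scalerA -scalerDr.
by rewrite !scalerA mulrC.
Qed.

(* As the original basis, the tilde basis is one of weight vectors. *)
Lemma jHtEt : jbracket jHt jEt = 2 *: jEt.
Proof.
rewrite /jEt jHt_comb ![jbracket _ (_ + _)]jbracketDr !jbracket_vec /jtable.
apply/ffunP => c; rewrite !coordE.
move: (jE c : C) (jF c : C) (jH c : C) => ? ? ?.
by field: sqri.
Qed.

Lemma jHtFt : jbracket jHt jFt = - 2 *: jFt.
Proof.
rewrite /jFt -scaleNr jHt_comb ![jbracket _ (_ + _)]jbracketDr !jbracket_vec /jtable.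
apply/ffunP => c; rewrite !coordE.
move: (jE c : C) (jF c : C) (jH c : C) => ? ? ?.
by field: sqri.
Qed.

Lemma jHtet r : jbracket jHt (jet r) = jet r.
Proof.
rewrite /jet jHt_comb !jbracket_vec /jtable.
apply/ffunP => c; rewrite !coordE.
move: (je r c : C) (jf r c : C) => ? ?.
by field: sqri.
Qed.

Lemma jHtft r : jbracket jHt (jft r) = - jft r.
Proof.
rewrite /jft -scaleNr jHt_comb !jbracket_vec /jtable.
apply/ffunP => c; rewrite !coordE.
move: (je r c : C) (jf r c : C) => ? ?.
by field: sqri.
Qed.

(* Weight for [jHt] together with commutation with the [jZt r s]. *)
Definition jwt : C -> jU -> Prop :=
  weight (jin jHt) [set u | exists r s, u = jin (jZt r s)].

Lemma jwt_in c x : jbracket jHt x = c *: x -> jwt c (jin x).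
Proof.
move=> hx; split=> [|z [r [s ->]]].
  by rewrite /jin -env_in_bracket hx linearZ.
apply/eqP; rewrite -subr_eq0 -env_in_bracket jbracketZl jbracketC.
by rewrite jbracket_central oppr0 scaler0 linear0.
Qed.

Lemma jwt_commutant u : jwt 0 u -> u \in commutant [set jin y | y in jk].
Proof.
rewrite /jwt /weight scale0r => -[/eqP]; rewrite subr_eq0 => /eqP hu zu.
have gen g : (g = jHt \/ exists r s, g = jZt r s) -> jin g * u = u * jin g.
  case=> [->|[r [s ->]]]; first exact: hu.
  by apply: zu; exists r, s.
apply/commutantP => _ [y + <-]; elim=> [|c g v Gg _ IH].
  by rewrite /jin linear0 mul0r mulr0.
have -> : jin (c *: g + v) = c *: jin g + jin v by apply: linearP.
by rewrite mulrDl mulrDr IH -scalerAl -scalerAr gen.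
Qed.

(* The classical E_nu and F_nu live in the quotient A of [jU] by the ideal of
   the [jZt r s] + delta_rs / 2; these are their evident lifts to [jU].  As
   [jD k] is also the quotient of the commutant of [jHt] in A by the left ideal
   of [jHt] - k, monomials in the lifts have the right classes in [jD k]. *)
Definition jEnu : jU := jin jEt + 2^-1 *: \sum_(r < N) jin (jet r) ^+ 2.
Definition jFnu : jU := jin jFt - 2^-1 *: \sum_(r < N) jin (jft r) ^+ 2.

Definition jmonE (i : nat) (I : {ffun 'I_N -> nat}) : jU :=
  jEnu ^+ i * \prod_(r < N) jin (jet r) ^+ I r.
Definition jmonF (i : nat) (I : {ffun 'I_N -> nat}) : jU :=
  jFnu ^+ i * \prod_(r < N) jin (jft r) ^+ I r.

Definition jweight (i : nat) (I : {ffun 'I_N -> nat}) : nat :=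
  (2 * i + \sum_(r < N) I r)%N.

Lemma jmonE_wt i I : jwt (jweight i I)%:R (jmonE i I).
Proof.
rewrite /jweight natrD natrM natr_sum; apply: weightM.
  rewrite mulr_natr; apply: weightX; apply: weightD; first exact/jwt_in/jHtEt.
  by apply/weightZ/weight_sum => r; apply/weightX/jwt_in; rewrite scale1r jHtet.
by apply: weight_prod => r; apply/weightX/jwt_in; rewrite scale1r jHtet.
Qed.

Lemma jmonF_wt i I : jwt (- (jweight i I)%:R) (jmonF i I).
Proof.
rewrite /jweight natrD natrM natr_sum opprD -sumrN; apply: weightM.
  rewrite -mulNr mulr_natr; apply: weightX; apply: weightD; first exact/jwt_in/jHtFt.
  rewrite -scaleNr; apply/weightZ/weight_sum => r; rewrite -mulNrn.
  by apply/weightX/jwt_in; rewrite scaleN1r jHtft.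
apply: weight_prod => r; rewrite -mulNrn.
by apply/weightX/jwt_in; rewrite scaleN1r jHtft.
Qed.

Section Monomials.
Variables (iF iE : nat) (If Ie : {ffun 'I_N -> nat}).
Variables (wFE : jweight iF If = jweight iE Ie).

Fact jmonFE_commutant :
  jmonF iF If * jmonE iE Ie \in commutant [set jin y | y in jk].
Proof.
by apply: jwt_commutant; have := weightM (jmonF_wt iF If) (jmonE_wt iE Ie);
  rewrite wFE addNr.
Qed.
Fact jmonEF_commutant :
  jmonE iE Ie * jmonF iF If \in commutant [set jin y | y in jk].
Proof.
by apply: jwt_commutant; have := weightM (jmonE_wt iE Ie) (jmonF_wt iF If);
  rewrite wFE addrN.
Qed.

Definition jmonFE : jUk := in_commutant jmonFE_commutant.
Definition jmonEF : jUk := in_commutant jmonEF_commutant.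
End Monomials.

(* The condition [w] says that the monomial commutes with [jHt]. *)
Definition jLf (k : C) : set (jD k) :=
  span [set d | exists iF iE If Ie (w : jweight iF If = jweight iE Ie),
    (0 < jweight iF If)%N /\ d = jpi k (jmonFE w)].

Definition jLe (k : C) : set (jD k) :=
  span [set d | exists iF iE If Ie (w : jweight iF If = jweight iE Ie),
    (0 < jweight iF If)%N /\ d = jpi k (jmonEF w)].

Definition is_character (k : C) (chi : jD k -> C) : Prop :=
  [/\ linear (chi : jD k -> C^o), monoid_morphism chi &
      forall c : C, exists d, chi d = c].

Definition kernel (k : C) (chi : jD k -> C) : set (jD k) := [set d | chi d = 0].

End Jacobi.

Arguments jLf {C} N k _.
Arguments jLe {C} N k _.

(* Main.v *)
From HB Require Import structures.
Require Import Defs.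
From mathcomp Require Import all_boot all_order all_algebra ring.
From mathcomp Require Import reals boolp classical_sets.
From mathcomp.real_closed Require Import complex.
From mathcomp.multinomials Require Import mpoly monalg.

Set Implicit Arguments.
Unset Strict Implicit.
Unset Printing Implicit Defensive.

Import GRing.Theory Num.Theory.
Local Open Scope ring_scope.
Local Open Scope classical_set_scope.
Local Notation span := Defs.span.

(** Let J be the two-sided ideal generated by the Z_rs + delta_rs / 2 (tilde basis
    throughout).  Modulo J the e_r and f_r satisfy the canonical commutation
    relations, and E_nu, F_nu commute with them and generate a copy of sl2 whose
    Cartan element is H + sum_r f_r e_r + N / 2.  So U(g) / J is a Weyl algebra
    tensored with U(sl2), graded by the eigenvalues of ad H, and a character of
    D_k is a functional on the elements of weight 0 that is multiplicative and
    vanishes on the left ideal I_k generated by H - k and J.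

    Symmetry.  Exchanging (E, e) with (F, f) and H with - H preserves these
    relations except that the sign of the commutator of e_r and f_s changes.
    The relations are therefore stated with a parameter w in place of that sign
    ([nu_rel]), and one argument serves both chi_f and chi_e.

    Spanning.  The products of a monomial in (F, f) with a monomial in (E, e)
    span U(g) modulo I_k, and the weight m part is spanned by the products of
    weight m ([weight_span]).  For m = 0 this says that D_k is the sum of the
    scalars and L_k^f; by symmetry the same holds for L_k^e.

    Existence.  On C[y, x_1, ..., x_N] the Verma module of sl2 and the Fock space
    of the Weyl algebra combine into a representation of g in which the constant
    polynomial 1 is killed by E_nu and all e_r and is an eigenvector of H of
    eigenvalue k.  An element of weight 0 acts on 1 by a scalar, because modulo
    the annihilator of 1 it is a scalar plus an element of L_k^f, which kills 1.
    This scalar is chi_f.  The automorphism H, E, F, e, f -> - H, - F, - E, f, - e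
    of g turns this module into one that yields chi_e in the same way.

    Uniqueness.  Let chi be a character.  It vanishes on commutators, which gives
    chi(f_r e_s) = 0 for r <> s and a common value m of all chi(f_r e_r); as
    N > 1, evaluating (f_r e_s)(f_s e_r) for r <> s gives m ^ 2 + w m = 0
    ([chi_fe_dichotomy]).  If m = 0, all chi(f_r e_s) vanish; otherwise m = - w
    and all chi(e_s f_r) vanish, which is the first case after the symmetry.  In
    the first case chi also vanishes on F e_r e_s, f_r f_s E and F E.  A generator
    of L_k^f ends in e_r or E; rewriting what stands before this last letter as
    a combination of monomials with F and f on the right exhibits one of these
    elements as a right factor ([chi_low_up]).  Hence chi kills L_k^f, and
    since D_k is the sum of the scalars and L_k^f it equals chi_f. *)

(** * Linear combinations *)

(** Identities between linear combinations are decided by comparing coefficients: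
    both sides are reified over a common list of atoms, and the equalities of
    coefficients are left to the tactics for commutative rings and fields. *)
Section LinearExpressions.
Variables (K : comNzRingType) (V : lmodType K).

Inductive linexp : Type :=
| LVar of nat | LZero | LAdd of linexp & linexp | LOpp of linexp
| LScale of K & linexp.

Fixpoint linexp_eval (s : seq V) t : V :=
  match t with
  | LVar i => nth 0 s i
  | LZero => 0
  | LAdd t1 t2 => linexp_eval s t1 + linexp_eval s t2
  | LOpp t1 => - linexp_eval s t1
  | LScale a t1 => a *: linexp_eval s t1
  end.

Fixpoint linexp_coef t (i : nat) : K :=
  match t with
  | LVar j => if Nat.eqb i j then 1 else 0
  | LZero => 0
  | LAdd t1 t2 => linexp_coef t1 i + linexp_coef t2 i
  | LOpp t1 => - linexp_coef t1 i
  | LScale a t1 => a * linexp_coef t1 i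
  end.

Fixpoint linexp_same t1 t2 (n : nat) : Prop :=
  if n is m.+1 then linexp_coef t1 m = linexp_coef t2 m /\ linexp_same t1 t2 m
  else True.

Lemma linexp_evalE s t :
  linexp_eval s t = \sum_(i < size s) linexp_coef t i *: nth 0 s i.
Proof.
elim: t => [j||t1 IH1 t2 IH2|t IH|a t IH] /=; rewrite ?IH1 ?IH2 ?IH.
- have eE i : Nat.eqb i j = (i == j :> nat) by elim: i j => [|i IHi] [|j] //=; rewrite IHi.
  under eq_bigr do rewrite eE (fun_if (fun a => a *: _)) scale1r scale0r.
  have [js|sj] := ltnP j (size s); last first.
    by rewrite nth_default // big1 // => i _; rewrite ltn_eqF // (leq_trans _ sj).
  rewrite (bigD1 (Ordinal js)) //= eqxx big1 ?addr0 // => i.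
  by rewrite -val_eqE /= => /negPf->.
- by rewrite big1 // => i _; rewrite scale0r.
- by rewrite -big_split; apply: eq_bigr => i _; rewrite scalerDl.
- by rewrite -sumrN; apply: eq_bigr => i _; rewrite scaleNr.
- by rewrite scaler_sumr; apply: eq_bigr => i _; rewrite scalerA.
Qed.

Lemma linexp_eq s t1 t2 :
  linexp_same t1 t2 (size s) -> linexp_eval s t1 = linexp_eval s t2.
Proof.
rewrite !linexp_evalE; elim: (size s) => [|n IH] /=; first by rewrite !big_ord0.
by case=> e /IH; rewrite !big_ord_recr /= e => ->.
Qed.

End LinearExpressions.

(** Units and products are compared up to the path of structures through which
    they were elaborated; all other atoms must agree syntactically. *)
Ltac lin_same x y :=
  match constr:(Set) with
  | _ => let _ := match constr:(Set) with _ => constr_eq x y end in constr:(true)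
  | _ => lazymatch x with
    | @GRing.one _ =>
        lazymatch y with @GRing.one _ => constr:(true) | _ => constr:(false) end
    | @GRing.mul _ ?a ?b => lazymatch y with
      | @GRing.mul _ ?c ?d =>
        let r := lin_same a c in
        lazymatch r with true => lin_same b d | false => constr:(false) end
      | _ => constr:(false)
      end
    | _ => constr:(false)
    end
  end.

Ltac lin_mem x s :=
  lazymatch s with
  | nil => constr:(false)
  | cons ?y ?s' => let b := lin_same x y in
    lazymatch b with true => constr:(true) | false => lin_mem x s' end
  end.

Ltac lin_index x s :=
  lazymatch s with
  | cons ?y ?s' => let b := lin_same x y in
    lazymatch b with
    | true => constr:(O)
    | false => let i := lin_index x s' in constr:(S i)
    end
  end.

Ltac lin_atoms s t :=
  lazymatch t with
  | @GRing.zero _ => s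
  | @GRing.add _ ?t1 ?t2 => let s1 := lin_atoms s t1 in lin_atoms s1 t2
  | @GRing.opp _ ?t1 => lin_atoms s t1
  | @GRing.scale _ _ _ ?t1 => lin_atoms s t1
  | _ => let b := lin_mem t s in
         lazymatch b with true => s | false => constr:(cons t s) end
  end.

Ltac lin_quote K s t :=
  lazymatch t with
  | @GRing.zero _ => constr:(@LZero K)
  | @GRing.add _ ?t1 ?t2 =>
      let q1 := lin_quote K s t1 in let q2 := lin_quote K s t2 in
      constr:(@LAdd K q1 q2)
  | @GRing.opp _ ?t1 => let q1 := lin_quote K s t1 in constr:(@LOpp K q1)
  | @GRing.scale _ _ ?a ?t1 => let q1 := lin_quote K s t1 in constr:(@LScale K a q1)
  | _ => let i := lin_index t s in constr:(@LVar K i)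
  end.

Ltac linear_over K :=
  lazymatch goal with
  | |- @eq ?T ?x ?y =>
    let s0 := lin_atoms (@nil T) x in
    let s := lin_atoms s0 y in
    let q1 := lin_quote K s x in
    let q2 := lin_quote K s y in
    refine (@linexp_eq K _ s q1 q2 _);
    cbn [size linexp_same linexp_coef Nat.eqb]
  end.

Ltac lin_ring K := linear_over K; do ?[split]; first [done | ring].

Ltac lin_field K := linear_over K; do ?[split]; first [done | by field].

Section Span.
Variables (K : pzRingType) (V : lmodType K) (G : set V).

Lemma span_gen g : G g -> span G g.
Proof. by move=> Gg; rewrite -[g]scale1r -[1 *: g]addr0; apply: SpanD => //; apply: Span0. Qed.

Lemma spanDD x y : span G x -> span G y -> span G (x + y).
Proof.
move=> + Gy; elim=> [|c g v Gg _ IH]; first by rewrite add0r.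
by rewrite -addrA; apply: SpanD.
Qed.

Lemma spanZ c x : span G x -> span G (c *: x).
Proof.
elim=> [|d g v Gg _ IH]; first by rewrite scaler0; apply: Span0.
by rewrite scalerDr scalerA; apply: SpanD.
Qed.

End Span.

(** * Monomials in weighted letters and oscillator relations *)

Section LetterMonomials.
Variables (A : pzRingType) (n : nat) (g : 'I_n -> A) (G : A).

(** Words are used rather than exponents, so that a letter can be split off at
    either end. *)
Inductive lmon : nat -> A -> Prop :=
| Lmon1 : lmon 0 1
| Lmon_g r a x : lmon a x -> lmon a.+1 (g r * x)
| Lmon_G a x : lmon a x -> lmon a.+2 (G * x).

Lemma lmon_gr r a x : lmon a x -> lmon a.+1 (x * g r).
Proof.
elim=> [|s b y _ IH|b y _ IH]; last 2 first.
- by rewrite -mulrA; apply: Lmon_g.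
- by rewrite -mulrA; apply: Lmon_G.
by rewrite mul1r -[g r]mulr1; apply/Lmon_g/Lmon1.
Qed.

Lemma lmonX a : lmon a.*2 (G ^+ a).
Proof. by elim: a => [|a IH]; [apply: Lmon1|rewrite exprS doubleS; apply: Lmon_G]. Qed.

Lemma lmon_last a x : lmon a x ->
  [\/ a = 0%N /\ x = 1,
      exists b r y, [/\ a = b.+1, lmon b y & x = y * g r] |
      exists b y, [/\ a = b.+2, lmon b y & x = y * G]].
Proof.
elim=> [|r b y Ly IH|b y Ly IH]; first by constructor 1.
- case: IH => [[-> ->]|[c [s [z [-> Lz ->]]]]|[c [z [-> Lz ->]]]].
  + by constructor 2; exists 0%N, r, 1; rewrite mulr1 mul1r; split=> //; apply: Lmon1.
  + by constructor 2; exists c.+1, s, (g r * z); rewrite mulrA; split=> //; apply: Lmon_g.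
  + by constructor 3; exists c.+1, (g r * z); rewrite mulrA; split=> //; apply: Lmon_g.
- case: IH => [[-> ->]|[c [s [z [-> Lz ->]]]]|[c [z [-> Lz ->]]]].
  + by constructor 3; exists 0%N, 1; rewrite mulr1 mul1r; split=> //; apply: Lmon1.
  + by constructor 2; exists c.+2, s, (G * z); rewrite mulrA; split=> //; apply: Lmon_G.
  + by constructor 3; exists c.+2, (G * z); rewrite mulrA; split=> //; apply: Lmon_G.
Qed.

(** Since [G] commutes with the [g r], any occurrence of some [g r] can be moved to
    the right end; otherwise the word is a power of [G]. *)
Lemma lmon_split a x : (forall r, G * g r = g r * G) -> lmon a x ->
  (exists b r y, [/\ a = b.+1, lmon b y & x = y * g r]) \/
  (exists b, a = b.*2 /\ x = G ^+ b).
Proof.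
move=> Gg; elim=> [|r b y Ly IH|b y Ly IH]; first by right; exists 0%N.
- left; case: IH => [[c [s [z [-> Lz ->]]]]|[c [eb ->]]].
    by exists c.+1, s, (g r * z); rewrite mulrA; split=> //; apply: Lmon_g.
  exists b, r, (G ^+ c); split=> //; first by rewrite eb; apply: lmonX.
  by apply: commrX; rewrite /GRing.comm Gg.
- case: IH => [[c [s [z [-> Lz ->]]]]|[c [-> ->]]].
    by left; exists c.+2, s, (G * z); rewrite mulrA; split=> //; apply: Lmon_G.
  by right; exists c.+1; rewrite exprS.
Qed.

End LetterMonomials.

Section NuRelations.
Variables (C : numFieldType) (U : algType C) (J : twoSidedIdeal U) (S : set U).
Variable N : nat.

(** The letters are those of a Weyl algebra and of an sl2 commuting with it.  The
    weights and the commutations inside (E, e) and inside (F, f) hold exactly, so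
    that monomials have exact weights; the remaining relations hold modulo [J].
    The sign [w] makes the relations stable under [nu_rel_swap]. *)
Record nu_rel (w c : C) (H E F : U) (e f : 'I_N -> U) : Prop := NuRel {
  nu_wtE : weight H S 2 E;
  nu_wtF : weight H S (-2) F;
  nu_wte : forall r, weight H S 1 (e r);
  nu_wtf : forall r, weight H S (-1) (f r);
  nu_ee : forall r s, e r * e s = e s * e r;
  nu_ff : forall r s, f r * f s = f s * f r;
  nu_Ee : forall r, E * e r = e r * E;
  nu_Ff : forall r, F * f r = f r * F;
  nu_ef : forall r s, e r * f s - f s * e r - (w * (r == s)%:R)%:A \in J;
  nu_Ef : forall r, E * f r - f r * E \in J;
  nu_Fe : forall r, F * e r - e r * F \in J;
  nu_EF : E * F - F * E - (H + w *: (\sum_r f r * e r) + c%:A) \in J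
}.

(** An induction principle for [U]: up to [J], every element is obtained from 1 by
    multiplying on the left by letters and taking linear combinations. *)
Definition left_generated (H E F : U) (e f : 'I_N -> U) : Prop :=
  forall Q : U -> Prop, Q 1 -> (forall a x y, Q x -> Q y -> Q (a *: x + y)) ->
  (forall x, x \in J -> Q x) ->
  (forall x, Q x -> [/\ Q (H * x), Q (E * x) & Q (F * x)]) ->
  (forall r x, Q x -> Q (e r * x) /\ Q (f r * x)) -> forall x, Q x.

Definition kideal (H : U) (k : C) : set U :=
  left_ideal [set u | u = H - k%:A \/ u \in J].

Lemma weightNl H c u : weight H S c u -> weight (- H) S (- c) u.
Proof.
by case=> hu zu; split=> //; rewrite mulNr mulrN scaleNr -hu opprB opprK addrC.
Qed.

Lemma weight0Nl H u : weight H S 0 u -> weight (- H) S 0 u.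
Proof. by move=> /weightNl; rewrite oppr0. Qed.

Lemma kidealN H k x : kideal H k x -> kideal (- H) (- k) x.
Proof.
elim=> [|a g y Gg _ IH]; first exact: LIdeal0.
rewrite -[a * g]mulrNN; apply: LIdealD => //.
case: Gg => [->|Jg]; [left|right; rewrite rpredN //].
by rewrite opprD opprK scaleNr opprK.
Qed.

(** The constant changes because the sum of the e_r f_r is that of the f_r e_r
    plus w N. *)
Lemma nu_rel_swap w c H E F e f : nu_rel w c H E F e f ->
  nu_rel (- w) (w ^+ 2 * N%:R - c) (- H) F E f e.
Proof.
case=> wE wF we wf ee ff Ee Ff ef Ef Fe EF; split=> // [||r|r|r s|].
- by have := weightNl wF; rewrite opprK.
- exact: weightNl.
- by have := weightNl (wf r); rewrite opprK.
- exact: weightNl.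
- have -> : f r * e s - e s * f r - (- w * (r == s)%:R)%:A =
    - (e s * f r - f r * e s - (w * (s == r)%:R)%:A).
    by rewrite eq_sym; lin_ring C.
  by rewrite rpredN.
have sumE : \sum_r e r * f r - \sum_r f r * e r - (w * N%:R)%:A =
  \sum_r (e r * f r - f r * e r - (w * (r == r)%:R)%:A).
  rewrite !sumrB; congr (_ - _); rewrite (eq_bigr (fun=> w%:A)) => [|r _].
    by rewrite sumr_const card_ord -scaler_nat scalerA mulrC.
  by rewrite eqxx mulr1.
have -> : F * E - E * F - (- H + - w *: (\sum_r e r * f r) + (w ^+ 2 * N%:R - c)%:A)
   = - (E * F - F * E - (H + w *: (\sum_r f r * e r) + c%:A))
     + w%:A * (\sum_r e r * f r - \sum_r f r * e r - (w * N%:R)%:A).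
  by rewrite mulr_algl; lin_ring C.
apply: rpredD; first by rewrite rpredN.
by apply: two_sidedMl; rewrite sumE; apply: rpred_sum => r _; apply: ef.
Qed.

End NuRelations.

(** * Spanning by monomials of a given weight *)
Section WeightMonomials.
Variables (C : numFieldType) (U : algType C) (S : set U) (N : nat).

Definition weight_mon (E F : U) (e f : 'I_N -> U) (m : C) : set U :=
  [set x | exists a b u v,
    [/\ m = b%:R - a%:R, lmon f F a u, lmon e E b v & x = u * v]].

Lemma lmon_weight H E (e : 'I_N -> U) (d : C) a x :
  weight H S (2 * d) E -> (forall r, weight H S d (e r)) ->
  lmon e E a x -> weight H S (a%:R * d) x.
Proof.
move=> wE we; elim=> [|r b y _ IH|b y _ IH].
- by rewrite mul0r; apply: weight1.
- by rewrite mulrS mulrDl mul1r; apply: weightM.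
- by rewrite -addn2 natrD addrC mulrDl; apply: weightM.
Qed.

Lemma span_weight_mon_weight J w c H E F e f m x :
  nu_rel J S w c H E F e f -> span (weight_mon E F e f m) x -> weight H S m x.
Proof.
move=> rel; elim=> [|a g y Gg _ IH]; first exact: weight0.
apply: weightD => //; apply: weightZ.
have [p [q [u [v [-> Lu Lv ->]]]]] := Gg.
rewrite addrC -[q%:R]mulr1 -[- _]mulrN1; apply: weightM.
  by apply: (lmon_weight _ (nu_wtf rel) Lu); rewrite mulrN1; apply: nu_wtF rel.
by apply: (lmon_weight _ (nu_wte rel) Lv); rewrite mulr1; apply: nu_wtE rel.
Qed.

End WeightMonomials.

Section Spanning.
Variables (C : numFieldType) (U : algType C) (J : twoSidedIdeal U) (S : set U).
Variables (N : nat) (w c : C) (H E F : U) (e f : 'I_N -> U) (k : C).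
Hypothesis rel : nu_rel J S w c H E F e f.
Hypothesis gen : left_generated J H E F e f.

Let I := kideal J H k.
Let V m := span (weight_mon E F e f m).

Lemma kideal_sub x : x \in J -> I x.
Proof.
move=> Jx; rewrite -[x]addr0 -[x]mul1r; apply: LIdealD; last exact: LIdeal0.
by right.
Qed.

Lemma kidealZ a x : I x -> I (a *: x).
Proof. by move=> Ix; rewrite -mulr_algl; apply: left_idealMl. Qed.

Lemma kideal_mulH x : I (x * H - k *: x).
Proof.
have -> : x * H - k *: x = x * (H - k%:A) by rewrite mulrBr mulr_algr.
by rewrite -[_ * _]addr0; apply: LIdealD; [left|apply: LIdeal0].
Qed.

Let kidealMH x : I x -> I (x * H).
Proof.
move=> Ix; rewrite -[x * H](subrK (k *: x)); apply: left_idealD.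
  exact: kideal_mulH.
exact: kidealZ.
Qed.

(** Finite sums of monomial combinations, modulo [I], together with the list of the
    weights that occur: the list is what the projection onto one weight runs
    through. *)
Inductive graded_sum : seq C -> U -> Prop :=
| GSum0 x : I x -> graded_sum [::] x
| GSumD m s v x : V m v -> graded_sum s x -> graded_sum (m :: s) (v + x).

Let Q x := exists s, graded_sum s x.

Lemma graded_sumZ a s x : graded_sum s x -> graded_sum s (a *: x).
Proof.
elim=> [y Iy|m t v y Vv _ IH]; first by constructor; apply: kidealZ.
by rewrite scalerDr; constructor => //; apply: spanZ.
Qed.

Lemma graded_sum_addI s x y : I x -> graded_sum s y -> graded_sum s (x + y).
Proof.
move=> Ix; elim=> [z Iz|m t v z Vv _ IH]; first by constructor; apply: left_idealD.
by rewrite addrCA; constructor.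
Qed.

Lemma graded_sumD s t x y :
  graded_sum s x -> graded_sum t y -> graded_sum (s ++ t) (x + y).
Proof.
move=> + Gy; elim=> [z Iz|m r v z Vv _ IH] /=; first exact: graded_sum_addI.
by rewrite -addrA; constructor.
Qed.

Let QD x y : Q x -> Q y -> Q (x + y).
Proof. by move=> [s Gx] [t Gy]; exists (s ++ t); apply: graded_sumD. Qed.
Let QZ a x : Q x -> Q (a *: x).
Proof. by move=> [s Gx]; exists s; apply: graded_sumZ. Qed.
Let QI x : I x -> Q x.
Proof. by move=> Ix; exists [::]; constructor. Qed.
Let QJ x : x \in J -> Q x.
Proof. by move=> Jx; apply/QI/kideal_sub. Qed.
Let QV m x : V m x -> Q x.
Proof.
move=> Vx; exists [:: m]; rewrite -[x]addr0; constructor => //; constructor.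
exact: LIdeal0.
Qed.
Let Q_mon m x : weight_mon E F e f m x -> Q x.
Proof. by move=> Mx; apply: (@QV m); apply: span_gen. Qed.

(* a linear operation on U that preserves I and sends monomials into Q *)
(** As [I] is a left ideal, left multiplication can be checked on monomials. *)
Let Q_map (x : U) : (forall y m, weight_mon E F e f m y -> Q (x * y)) ->
  forall y, Q y -> Q (x * y).
Proof.
move=> hx y [s]; elim=> [z Iz|m t v z Vv _ IH].
  by apply: QI; apply: left_idealMl.
rewrite mulrDr; apply: QD => //; elim: Vv => [|a g u Mg _ IHu].
  by rewrite mulr0; apply: QI; apply: LIdeal0.
by rewrite mulrDr -scalerAr; apply: QD => //; apply: QZ; apply: hx Mg.
Qed.

Let QF x : Q x -> Q (F * x).
Proof.
apply: Q_map => _ m [a [b [u [v [_ Lu Lv ->]]]]]; rewrite mulrA.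
by apply: (@Q_mon (b%:R - a.+2%:R)); exists a.+2, b, (F * u), v; split=> //; apply: Lmon_G.
Qed.

Let Qf r x : Q x -> Q (f r * x).
Proof.
apply: Q_map => _ m [a [b [u [v [_ Lu Lv ->]]]]]; rewrite mulrA.
by apply: (@Q_mon (b%:R - a.+1%:R)); exists a.+1, b, (f r * u), v; split=> //; apply: Lmon_g.
Qed.

Let QH x : Q x -> Q (H * x).
Proof.
apply: Q_map => y m My.
have [hy _] := span_weight_mon_weight rel (span_gen My).
have -> : H * y = (y * H - k *: y) + (m + k) *: y.
  by rewrite scalerDl -hy; lin_ring C.
by apply: QD; [apply: QI; apply: kideal_mulH|apply/QZ/Q_mon/My].
Qed.

(** The Poincare-Birkhoff-Witt rewriting: a raising letter is moved through the
    lowering monomial.  The cases of [E] and [e] are proved together, because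
    moving [E] across [F] creates the terms [f r * e r]. *)
Let Q_raise a b u v : lmon f F a u -> lmon e E b v ->
  Q (E * (u * v)) /\ forall r, Q (e r * (u * v)).
Proof.
move=> + Lv; elim=> [|r p x Lx [IHE IHe]|p x Lx [IHE IHe]]; first split=> [|r].
- rewrite mul1r -[E * v]mul1r; apply: (@Q_mon (b.+2%:R - 0)).
  by exists 0%N, b.+2, 1, (E * v); split=> //; [apply: Lmon1|apply: Lmon_G].
- rewrite mul1r -[e r * v]mul1r; apply: (@Q_mon (b.+1%:R - 0)).
  by exists 0%N, b.+1, 1, (e r * v); split=> //; [apply: Lmon1|apply: Lmon_g].
- have Qxv : Q (x * v).
    by apply: (@Q_mon (b%:R - p%:R)); exists p, b, x, v.
  split=> [|s].
    have -> : E * (f r * x * v) = f r * (E * (x * v)) + (E * f r - f r * E) * (x * v).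
      by rewrite mulrBl !mulrA addrC subrK.
    by apply: QD; [apply: Qf|apply/QJ/two_sidedMr/(nu_Ef rel)].
  have -> : e s * (f r * x * v) = f r * (e s * (x * v)) + (w * (s == r)%:R) *: (x * v)
     + (e s * f r - f r * e s - (w * (s == r)%:R)%:A) * (x * v).
    by rewrite !mulrBl mulr_algl !mulrA; lin_ring C.
  apply: QD; last by apply/QJ/two_sidedMr/(nu_ef rel).
  by apply: QD; [apply: Qf|apply: QZ].
- have Qxv : Q (x * v).
    by apply: (@Q_mon (b%:R - p%:R)); exists p, b, x, v.
  split=> [|s].
    have -> : E * (F * x * v) = F * (E * (x * v)) +
       (H * (x * v) + w *: \sum_r f r * (e r * (x * v)) + c *: (x * v)) +
       (E * F - F * E - (H + w *: (\sum_r f r * e r) + c%:A)) * (x * v).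
      rewrite !(mulrBl, mulrDl, mulNr) mulr_algl -scalerAl mulr_suml.
      under [X in _ = _ + (_ + w *: X + _) + _]eq_bigr do rewrite mulrA.
      by rewrite !mulrA; set X := \sum_i _; lin_ring C.
    apply: QD; last by apply/QJ/two_sidedMr/(nu_EF rel).
    apply: QD; first exact: QF.
    apply: QD; last exact: QZ.
    apply: QD; first exact: QH.
    apply: QZ; elim/big_ind: _ => [||r _]; last by apply: Qf.
    + by apply: QI; apply: LIdeal0.
    + exact: QD.
  have -> : e s * (F * x * v) = F * (e s * (x * v)) - (F * e s - e s * F) * (x * v).
    by rewrite mulrBl !mulrA opprB addrC subrK.
  by apply: QD; [apply: QF|apply: QJ; rewrite rpredN; apply/two_sidedMr/(nu_Fe rel)].
Qed.

Lemma graded_span x : exists s, graded_sum s x.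
Proof.
apply: (gen (Q := Q)) x => [|a x y Qx Qy|||r x Qx].
- rewrite -[1]mul1r; apply: (@Q_mon (0 - 0)).
  by exists 0%N, 0%N, 1, 1; split=> //; apply: Lmon1.
- by apply: QD => //; apply: QZ.
- exact: QJ.
- move=> x Qx; split; [exact: QH| |exact: QF].
  by move: Qx; apply: Q_map => _ m [a [b [u [v [_ Lu Lv ->]]]]]; apply: (Q_raise Lu Lv).1.
- split; last exact: Qf.
  by move: Qx; apply: Q_map => _ m [a [b [u [v [_ Lu Lv ->]]]]]; apply: (Q_raise Lu Lv).2.
Qed.

Let T m x := H * x - x * H - m *: x.

Let T_sum s m x : graded_sum s x -> graded_sum s (T m x).
Proof.
elim=> [y Iy|p t v y Vv _ IH].
  constructor; apply: left_idealD; last by apply/left_idealN/kidealZ.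
  by apply: left_idealD; [apply: left_idealMl|apply/left_idealN/kidealMH].
have [hv _] := span_weight_mon_weight rel Vv.
have -> : T m (v + y) = (p - m) *: v + T m y.
  by rewrite /T mulrDl mulrDr scalerBl -hv; lin_ring C.
by constructor => //; apply: spanZ.
Qed.

(** If [x] has weight [m], then [ad H - p] multiplies [x] by [m - p], a nonzero
    scalar when [p <> m], and annihilates the component of weight [p]: the other
    weights are removed one at a time. *)
Lemma graded_sum_proj s m x : graded_sum s x -> H * x - x * H = m *: x ->
  exists v, V m v /\ I (x - v).
Proof.
elim: s x => [|p s IH] x Gx.
  by inversion Gx; subst => _; exists 0; split; [apply: Span0|rewrite subr0].
inversion Gx as [|p' s' v y Vv Gy]; subst => hx.
have [hv _] := span_weight_mon_weight rel Vv.
have [epm|nepm] := eqVneq p m.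
  subst p; have [|v' [Vv' Iv']] := IH y Gy.
    have -> : y = v + y - v by rewrite addrC addKr.
    by rewrite [in X in X = _]mulrBr mulrBl scalerBr -hx -hv; lin_ring C.
  by exists (v + v'); split; [apply: spanDD|rewrite opprD addrACA subrr add0r].
have mp0 : m - p != 0 by rewrite subr_eq0 eq_sym.
have -> : v + y = (m - p)^-1 *: T p (v + y).
  by rewrite /T hx -scalerBl scalerA mulVf // scale1r.
have Tv : T p (v + y) = T p y.
  by rewrite /T mulrDr mulrDl scalerDr -hv; lin_ring C.
apply: IH; first by rewrite Tv; apply/graded_sumZ/T_sum.
have -> : (m - p)^-1 *: T p (v + y) = v + y.
  by rewrite /T hx -scalerBl scalerA mulVf // scale1r.
exact: hx.
Qed.

Theorem weight_span m x : weight H S m x -> exists v, V m v /\ I (x - v).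
Proof. by have [s Gx] := graded_span x => -[hx _]; apply: graded_sum_proj Gx hx. Qed.

End Spanning.

(** * Characters on elements of weight zero *)

(** Products of elements of weight 0 computed in a ring where the oscillator
    relations hold exactly; [W] is the central commutator of e_r and f_r, and
    f_r e_r is called the number operator. *)
Section OscillatorIdentities.
Variables (A : pzRingType) (N : nat) (W E F : A) (e f : 'I_N -> A).
Hypothesis ef : forall r s, e r * f s = f s * e r + (r == s)%:R * W.
Hypothesis We : forall r, e r * W = W * e r.
Hypothesis Wf : forall r, f r * W = W * f r.
Hypothesis WF : F * W = W * F.
Hypothesis ee : forall r s, e r * e s = e s * e r.
Hypothesis ff : forall r s, f r * f s = f s * f r.
Hypothesis Ee : forall r, E * e r = e r * E.
Hypothesis Ef : forall r, E * f r = f r * E.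
Hypothesis Ff : forall r, F * f r = f r * F.
Hypothesis Fe : forall r, F * e r = e r * F.

Lemma shift_mul_shift r s : r != s ->
  (f r * e s) * (f s * e r) = (f r * e r) * (f s * e s) + W * (f r * e r).
Proof.
move=> /negPf nrs.
rewrite mulrA -[f r * e s * f s]mulrA ef eqxx mul1r mulrDr mulrDl.
congr (_ + _); last by rewrite mulrA Wf.
rewrite -[f r * e r * _]mulrA [e r * _]mulrA ef nrs mul0r addr0.
by rewrite -!mulrA [e s * e r]ee.
Qed.

Lemma number_mul_shift r s : r != s ->
  (f r * e r) * (f r * e s) = (f r * e s) * (f r * e r) + W * (f r * e s).
Proof.
move=> /negPf nrs; rewrite -!mulrA.
have -> : e s * (f r * e r) = f r * (e r * e s).
  by rewrite mulrA ef eq_sym nrs mul0r addr0 -mulrA ee.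
have -> : e r * (f r * e s) = f r * (e r * e s) + W * e s.
  by rewrite mulrA ef eqxx mul1r mulrDl -mulrA.
by rewrite mulrDr [f r * (W * _)]mulrA Wf -mulrA.
Qed.

Lemma Fee_mul_number r s :
  (F * (e r * e s)) * (f r * e r) = (f r * e r) * (F * (e r * e s))
     + (1 + (r == s)%:R) * (W * (F * (e r * e s))).
Proof.
have es : e s * (f r * e r) = f r * e r * e s + (r == s)%:R * (W * e r).
  by rewrite mulrA ef eq_sym mulrDl -!mulrA [e s * e r]ee.
have er : e r * (f r * e r) = f r * e r * e r + W * e r.
  by rewrite mulrA ef eqxx mul1r mulrDl -!mulrA.
have eer : e r * e s * (f r * e r) = f r * e r * (e r * e s)
     + (1 + (r == s)%:R) * (W * (e r * e s)).
  rewrite -mulrA es mulrDr mulrA er mulrDl -!mulrA -addrA; congr (_ + _).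
  rewrite mulrDl mul1r; congr (_ + _); have [<-|_] := eqVneq r s.
    by rewrite !mul1r mulrA We -mulrA.
  by rewrite !mul0r mulr0.
rewrite -mulrA eer mulrDr; congr (_ + _).
  by rewrite mulrA [F * _]mulrA Ff -[f r * F * _]mulrA Fe !mulrA.
rewrite !mulrDl !mul1r mulrDr; congr (_ + _); first by rewrite mulrA WF !mulrA.
by case: (r == s); rewrite ?mul1r ?mul0r ?mulr0 // mulrA WF !mulrA.
Qed.

Lemma number_mul_ffE r s :
  (f r * e r) * (f r * f s * E) = (f r * f s * E) * (f r * e r)
     + (1 + (r == s)%:R) * (W * (f r * f s * E)).
Proof.
have fs : f r * e r * f s = f s * (f r * e r) + (r == s)%:R * (W * f r).
  rewrite -mulrA ef mulrDr mulrA ff -mulrA; congr (_ + _).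
  by case: (r == s); rewrite ?mul1r ?mul0r ?mulr0 // Wf.
have fr : f r * e r * f r = f r * (f r * e r) + W * f r.
  by rewrite -mulrA ef eqxx mul1r mulrDr Wf.
have ffr : f r * e r * (f r * f s) = f r * f s * (f r * e r)
     + (1 + (r == s)%:R) * (W * (f r * f s)).
  rewrite mulrA fr mulrDl -[f r * (f r * e r) * f s]mulrA fs mulrDr -!mulrA -addrA.
  congr (_ + _); rewrite mulrDl mul1r addrC; congr (_ + _).
  have [<-|_] := eqVneq r s; last by rewrite !mul0r mulr0.
  by rewrite !mul1r mulrA Wf -mulrA.
rewrite [LHS]mulrA ffr mulrDl -!mulrA; congr (_ + _).
by rewrite [E * _]mulrA Ef -[f r * E * _]mulrA Ee.
Qed.

Lemma Fee_mul_ffE r :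
  (F * (e r * e r)) * (f r * f r * E) =
  (F * E) * ((e r * f r) * (e r * f r)) + W * ((F * E) * (e r * f r)).
Proof.
have eff : e r * e r * (f r * f r) = e r * f r * (e r * f r) + W * (e r * f r).
  rewrite -mulrA [e r * (f r * f r)]mulrA [in X in e r * X]ef eqxx mul1r.
  by rewrite mulrDl mulrDr -!mulrA [e r * (W * _)]mulrA We -!mulrA.
have En : E * (e r * f r) = e r * f r * E by rewrite mulrA Ee -mulrA Ef mulrA.
rewrite -[LHS]mulrA [_ * _ * (_ * E)]mulrA eff; set n := e r * f r in En *.
have Enn : E * (n * n) = n * n * E by rewrite mulrA En -mulrA En mulrA.
by rewrite mulrDl mulrDr -Enn -[W * n * E]mulrA -En mulrA [F * (W * _)]mulrA WF -!mulrA.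
Qed.

End OscillatorIdentities.

Section Characters.
Variables (C : numFieldType) (U : algType C) (J : twoSidedIdeal U) (S : set U).
Variables (N : nat).

(** A character of the quotient by [kideal H k], extended arbitrarily to all of
    [U]: only its values on elements of weight 0 are constrained. *)
Record wt0_character (H : U) (k : C) (chi : U -> C) : Prop := Wt0Character {
  chiP : forall a u v, weight H S 0 u -> weight H S 0 v ->
    chi (a *: u + v) = a * chi u + chi v;
  chiM : forall u v, weight H S 0 u -> weight H S 0 v -> chi (u * v) = chi u * chi v;
  chi1 : chi 1 = 1;
  chi_kideal : forall u, weight H S 0 u -> kideal J H k u -> chi u = 0
}.

Lemma wt0_characterN H k chi : wt0_character H k chi -> wt0_character (- H) (- k) chi.
Proof.
have wN u : weight (- H) S 0 u -> weight H S 0 u by move=> /weight0Nl; rewrite opprK.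
case=> cP cM c1 cI; split=> // [a u v /wN wu /wN wv|u v /wN wu /wN wv|u /wN wu].
- exact: cP.
- exact: cM.
- by move=> /kidealN; rewrite !opprK; apply: cI.
Qed.

Section Fixed.
Variables (w c : C) (H E F : U) (e f : 'I_N -> U) (k : C) (chi : U -> C).
Hypothesis rel : nu_rel J S w c H E F e f.
Hypothesis chr : wt0_character H k chi.

Local Notation wt := (weight H S).
Local Notation p := (aq_pi J).

Lemma weight_eq a b u : wt a u -> a = b -> wt b u.
Proof. by move=> wu <-. Qed.

Let wfe r s : wt 0 (f r * e s).
Proof. by apply: weight_eq (weightM (nu_wtf rel r) (nu_wte rel s)) _; ring. Qed.
Let wef r s : wt 0 (e r * f s).
Proof. by apply: weight_eq (weightM (nu_wte rel r) (nu_wtf rel s)) _; ring. Qed.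
Let wFE : wt 0 (F * E).
Proof. by apply: weight_eq (weightM (nu_wtF rel) (nu_wtE rel)) _; ring. Qed.
Let wFee r s : wt 0 (F * (e r * e s)).
Proof.
apply: weight_eq (weightM (nu_wtF rel) (weightM (nu_wte rel r) (nu_wte rel s))) _.
by ring.
Qed.
Let wffE r s : wt 0 (f r * f s * E).
Proof.
apply: weight_eq (weightM (weightM (nu_wtf rel r) (nu_wtf rel s)) (nu_wtE rel)) _.
by ring.
Qed.
Let wM u v : wt 0 u -> wt 0 v -> wt 0 (u * v).
Proof. by move=> wu wv; rewrite -[0]addr0; apply: weightM. Qed.

Let chi0 : chi 0 = 0.
Proof. by apply: (chi_kideal chr); [apply: weight0|apply: LIdeal0]. Qed.
Let chiD u v : wt 0 u -> wt 0 v -> chi (u + v) = chi u + chi v.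
Proof. by move=> wu wv; rewrite -[u]scale1r (chiP chr) // mul1r scale1r. Qed.
Let chiZ a u : wt 0 u -> chi (a *: u) = a * chi u.
Proof. by move=> wu; rewrite -[a *: u]addr0 (chiP chr) // ?chi0 ?addr0 //; apply: weight0. Qed.

Let chi_kcongr u v : wt 0 u -> wt 0 v -> kideal J H k (u - v) -> chi u = chi v.
Proof.
move=> wu wv Iuv; have wuv : wt 0 (u - v).
  by rewrite -scaleN1r; apply: weightD => //; apply: weightZ.
by rewrite -[u](subrK v) chiD // (chi_kideal chr) ?add0r.
Qed.

Let chi_congr u v : wt 0 u -> wt 0 v -> p u = p v -> chi u = chi v.
Proof. by move=> wu wv /aq_piP Juv; apply: chi_kcongr => //; apply: kideal_sub. Qed.

Let W := p w%:A.
Let pscale a x : p (a *: x) = p a%:A * p x.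
Proof. by rewrite -rmorphM mulr_algl. Qed.
Let pnat b : p (b%:R : C)%:A = b%:R.
Proof. by rewrite scaler_nat; apply: (rmorph_nat (aq_pi J)). Qed.
Let pscalar a x : p x * p a%:A = p a%:A * p x.
Proof. by rewrite -!rmorphM mulr_algl mulr_algr. Qed.
Let peq x y : x - y \in J -> p x = p y.
Proof. by move=> Jxy; apply/aq_piP. Qed.

Let pef r s : p (e r) * p (f s) = p (f s) * p (e r) + (r == s)%:R * W.
Proof.
have /peq := nu_ef rel r s; rewrite rmorphB !rmorphM => /eqP.
rewrite subr_eq addrC => /eqP->; congr (_ + _); rewrite /W.
by case: (r == s); rewrite ?mulr1 ?mul1r // mulr0 mul0r scale0r rmorph0.
Qed.
Let pEf r : p E * p (f r) = p (f r) * p E.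
Proof. by rewrite -!rmorphM; apply/peq/(nu_Ef rel). Qed.
Let pFe r : p F * p (e r) = p (e r) * p F.
Proof. by rewrite -!rmorphM; apply/peq/(nu_Fe rel). Qed.
Let pee r s : p (e r) * p (e s) = p (e s) * p (e r).
Proof. by rewrite -!rmorphM (nu_ee rel). Qed.
Let pff r s : p (f r) * p (f s) = p (f s) * p (f r).
Proof. by rewrite -!rmorphM (nu_ff rel). Qed.
Let pEe r : p E * p (e r) = p (e r) * p E.
Proof. by rewrite -!rmorphM (nu_Ee rel). Qed.
Let pFf r : p F * p (f r) = p (f r) * p F.
Proof. by rewrite -!rmorphM (nu_Ff rel). Qed.

Lemma chi_ef r s : chi (e s * f r) = chi (f r * e s) + w * (r == s)%:R.
Proof.
have -> : chi (e s * f r) = chi (f r * e s + (w * (r == s)%:R)%:A).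
  apply: chi_congr => //.
    by apply: weightD => //; apply/weightZ/weight1.
  apply/peq; have -> : e s * f r - (f r * e s + (w * (r == s)%:R)%:A) =
     e s * f r - f r * e s - (w * (s == r)%:R)%:A.
    by rewrite eq_sym opprD addrA.
  exact: nu_ef rel s r.
by rewrite chiD ?chiZ ?(chi1 chr) ?mulr1 //; [apply: weight1|apply/weightZ/weight1].
Qed.

(** Transfers the multiplication rules of the exact oscillator algebra to [chi]. *)
Let chi_mul_add u v x y b : wt 0 u -> wt 0 v -> wt 0 x -> wt 0 y ->
  p (u * v) = p x + b%:R * (W * p y) -> chi u * chi v = chi x + b%:R * (w * chi y).
Proof.
move=> wu wv wx wy euv; rewrite -(chiM chr) // -!chiZ //; last exact: weightZ.
rewrite -chiD //; last by do 2!apply: weightZ.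
apply: chi_congr; [exact: wM| |].
  by apply: weightD => //; do 2!apply: weightZ.
by rewrite euv aq_piD (pscale _ (w *: y)) (pscale w y) pnat.
Qed.

(** With m the common value of the chi(f_r e_r), the product of f_r e_s and f_s e_r
    gives 0 = m ^ 2 + w m. *)
Lemma chi_fe_dichotomy : (1 < N)%N -> w != 0 ->
  (forall r s, chi (f r * e s) = 0) \/ (forall r s, chi (e s * f r) = 0).
Proof.
move=> N1 w0.
have off r s : r != s -> chi (f r * e s) = 0.
  move=> nrs; have /eqP : chi (f r * e r) * chi (f r * e s) =
     chi (f r * e s) * chi (f r * e r) + 1%:R * (w * chi (f r * e s)).
    rewrite -[X in _ = X + _](chiM chr) //; apply: chi_mul_add => //; first exact: wM.
    rewrite !rmorphM mul1r.
    by apply: (@number_mul_shift _ _ W _ _ pef) => // i; apply: pscalar.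
  rewrite mulrC mul1r addrC -subr_eq subrr eq_sym mulf_eq0 (negPf w0) /=.
  by move=> /eqP.
have diag r s : r != s -> 0 = chi (f r * e r) * chi (f s * e s) + w * chi (f r * e r).
  move=> nrs; have : chi (f r * e s) * chi (f s * e r) =
     chi (f r * e r * (f s * e s)) + 1%:R * (w * chi (f r * e r)).
    apply: chi_mul_add => //; first exact: wM.
    by rewrite !rmorphM mul1r; apply: (@shift_mul_shift _ _ W _ _ pef) => // i; apply: pscalar.
  by rewrite off // mul0r mul1r (chiM chr).
have same r s : chi (f r * e r) = chi (f s * e s).
  have [->//|nrs] := eqVneq r s.
  have := diag r s nrs; rewrite {1}(diag s r); last by rewrite eq_sym.
  by rewrite [X in X + _]mulrC => /addrI/(mulfI w0).
pose r0 : 'I_N := Ordinal (ltnW N1).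
pose r1 : 'I_N := Ordinal N1.
have := diag r0 r1 isT; rewrite -(same r0 r1) -mulrDl => /esym/eqP.
rewrite mulf_eq0 => /orP[|/eqP m0]; last first.
  left=> r s; have [<-|] := eqVneq r s; last exact: off.
  by rewrite (same r r0).
move=> /eqP mw; right=> r s; rewrite chi_ef.
have [<-|nrs] := eqVneq r s; first by rewrite mulr1 (same r r0).
by rewrite mulr0 addr0 off.
Qed.

Hypothesis w0 : w != 0.
Hypothesis chi_fe : forall r s, chi (f r * e s) = 0.

Let nz b : (1 + b%:R : C) != 0 .
Proof. by rewrite nat1r pnatr_eq0. Qed.

(** F e_r e_s is an eigenvector of the commutator with f_r e_r, of nonzero
    eigenvalue, hence a commutator; a character kills it.  The same holds for
    f_r f_s E. *)
Let chi_Fee r s : chi (F * (e r * e s)) = 0.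
Proof.
have : chi (F * (e r * e s)) * chi (f r * e r) =
  chi ((f r * e r) * (F * (e r * e s))) +
   (1 + (r == s))%:R * (w * chi (F * (e r * e s))).
  apply: chi_mul_add => //; first exact: wM.
  rewrite !rmorphM natrD; apply: (@Fee_mul_number _ _ W _ _ _ pef) => //.
  - by move=> i; apply: pscalar.
  - exact: pscalar.
rewrite (chiM chr (wfe r r) (wFee r s)) chi_fe mulr0 mul0r add0r => /esym/eqP.
by rewrite !mulf_eq0 natrD (negPf (nz _)) (negPf w0) /= => /eqP.
Qed.

Let chi_ffE r s : chi (f r * f s * E) = 0.
Proof.
have : chi (f r * e r) * chi (f r * f s * E) =
  chi ((f r * f s * E) * (f r * e r)) +
   (1 + (r == s))%:R * (w * chi (f r * f s * E)).
  apply: chi_mul_add => //; first exact: wM.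
  rewrite !rmorphM natrD; apply: (@number_mul_ffE _ _ W _ _ _ pef) => //.
  by move=> i; apply: pscalar.
rewrite (chiM chr (wffE r s) (wfe r r)) chi_fe mulr0 mul0r add0r => /esym/eqP.
by rewrite !mulf_eq0 natrD (negPf (nz _)) (negPf w0) /= => /eqP.
Qed.

Variable r0 : 'I_N.

(** The product (F e_r e_r)(f_r f_r E), which the character kills, is F E times
    n ^ 2 + w n with n = e_r f_r; as chi(n) = w, this last factor has the nonzero
    value 2 w ^ 2. *)
Let chi_FE (r : 'I_N) : chi (F * E) = 0.
Proof.
have wn := wef r r.
have ce : chi (e r * f r) = w by rewrite chi_ef chi_fe eqxx mulr1 add0r.
have : chi (F * (e r * e r)) * chi (f r * f r * E) =
  chi ((F * E) * ((e r * f r) * (e r * f r))) + 1%:R * (w * chi ((F * E) * (e r * f r))).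
  apply: chi_mul_add => //; [exact: (wM wFE (wM wn wn))|exact: (wM wFE wn)|].
  rewrite !rmorphM mul1r; apply: (@Fee_mul_ffE _ _ W _ _ _ _ pef) => //.
  - by move=> i; apply: pscalar.
  - exact: pscalar.
rewrite chi_Fee mul0r (chiM chr wFE (wM wn wn)) (chiM chr wn wn) (chiM chr wFE wn).
rewrite ce => /esym/eqP.
have -> : chi (F * E) * (w * w) + 1%:R * (w * (chi (F * E) * w)) =
  2%:R * (w * w) * chi (F * E) by ring.
by rewrite !mulf_eq0 (negPf w0) pnatr_eq0 /= => /eqP.
Qed.

Hypothesis gen : left_generated J H E F e f.

Lemma left_generated_swap : left_generated J (- H) F E f e.
Proof.
move=> Q Q1 Qlin QJ QHEF Qef; apply: gen => // [x Qx|r x Qx].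
  have [QHx QFx QEx] := QHEF x Qx; split=> //.
  have Q0 : Q 0 by apply: QJ; apply: rpred0.
  by have := Qlin (- 1) _ _ QHx Q0; rewrite mulNr scaleNr scale1r opprK addr0.
by have [? ?] := Qef r x Qx.
Qed.

(** Moving H - (k + d) to the right across an element of weight d turns it into
    H - k. *)
Lemma kideal_shift d x u : wt d x -> kideal J H (k + d) u -> kideal J H k (u * x).
Proof.
case=> hx _; elim=> [|a g y Gg _ IH]; first by rewrite mul0r; apply: LIdeal0.
rewrite mulrDl; apply: left_idealD => //; rewrite -mulrA; apply: left_idealMl.
case: Gg => [->|Jg]; last by apply: kideal_sub; apply: two_sidedMr.
have -> : (H - (k + d)%:A) * x = x * (H - k%:A) + 0.
  have eHx : H * x = x * H + d *: x by rewrite -hx addrC subrK.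
  by rewrite mulrBl mulrBr mulr_algl mulr_algr eHx; lin_ring C.
by apply: LIdealD; [left|apply: LIdeal0].
Qed.

Let wt_low a x : lmon f F a x -> wt (- a%:R) x.
Proof.
move=> Lx; rewrite -mulrN1; apply: (lmon_weight _ (nu_wtf rel) Lx).
by rewrite mulrN1; apply: nu_wtF rel.
Qed.
Let wt_up a x : lmon e E a x -> wt a%:R x.
Proof.
move=> Lx; rewrite -[a%:R]mulr1; apply: (lmon_weight _ (nu_wte rel) Lx).
by rewrite mulr1; apply: nu_wtE rel.
Qed.

(** To show that [chi] kills all [y * x], it suffices to let [y] range over the
    monomials with the lowering letters on the right: these span modulo
    [kideal H (k + d)], and multiplying by [x] brings this ideal into
    [kideal H k]. *)
Let chi_mul_right d x y : wt d x -> wt (- d) y ->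
  (forall u v a b, lmon e E a u -> lmon f F b v -> b%:R = a%:R + d -> chi (u * v * x) = 0) ->
  chi (y * x) = 0.
Proof.
move=> wx wy hmon.
have [v [Vv Iv]] := weight_span (- (k + d)) (nu_rel_swap rel) left_generated_swap (weightNl wy).
move: Iv => /kidealN; rewrite !opprK => /(kideal_shift wx); rewrite mulrBl => Iyv.
have wv : wt (- d) v.
  by have := weightNl (span_weight_mon_weight (nu_rel_swap rel) Vv); rewrite !opprK.
have w0M z : wt (- d) z -> wt 0 (z * x).
  by move=> wz; apply: weight_eq (weightM wz wx) _; rewrite addNr.
rewrite (chi_kcongr _ _ Iyv); try exact: w0M.
elim: Vv => [|a g z Gg Vz IH]; first by rewrite mul0r chi0.
have wz : wt (- d) z.
  by have := weightNl (span_weight_mon_weight (nu_rel_swap rel) Vz); rewrite !opprK.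
have wg : wt (- d) g.
  have := weightNl (span_weight_mon_weight (nu_rel_swap rel) (span_gen Gg)).
  by rewrite !opprK.
rewrite mulrDl -scalerAl (chiP chr); try exact: w0M.
rewrite IH addr0; case: Gg => [q [b [u [t [edq Lu Lt ->]]]]].
rewrite (hmon u t q b) ?mulr0 //.
by rewrite -[d]opprK edq addrC subrK.
Qed.

Let wt_ud a u b v d : lmon e E a u -> lmon f F b v -> a%:R - b%:R = d -> wt d (u * v).
Proof. by move=> Lu Lv <-; apply: weightM; [apply: wt_up|apply: wt_low]. Qed.

Let chi_mul_e r y : wt (- 1) y -> chi (y * e r) = 0.
Proof.
move=> wy; apply: (chi_mul_right (nu_wte rel r) wy) => u v a b Lu Lv.
rewrite natr1 => /eqP; rewrite eqr_nat => /eqP eb.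
have [[b' [s [v' [eb' Lv' ->]]]]|[b' [eb' ev]]] := lmon_split (nu_Ff rel) Lv.
  rewrite mulrA -mulrA (chiM chr) ?chi_fe ?mulr0 //.
  by apply: (wt_ud Lu Lv'); move: eb; rewrite eb' => -[->]; rewrite subrr.
have [[a' [s [u' [ea' Lu' ->]]]]|[a' [ea' _]]] := lmon_split (nu_Ee rel) Lu; last first.
  (* b = a + 1 excludes that both monomials are powers of the letters of weight 2 *)
  by move/(congr1 odd): eb; rewrite eb' ea' /= !odd_double.
case: b' eb' ev => [|b'] eb' ->; first by rewrite eb' in eb.
have wuF : wt 0 (u' * F ^+ b').
  apply: (wt_ud Lu' (lmonX f F b')); move: eb; rewrite eb' ea' doubleS => -[->].
  by rewrite subrr.
rewrite -[RHS](mulr0 (chi (u' * F ^+ b'))) -(chi_Fee s r) -(chiM chr) //.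
apply: chi_congr; last 2 first.
- exact: wM.
- rewrite exprSr !rmorphM rmorphXn -!mulrA.
  rewrite [p F * (p (e s) * _)]mulrA pFe -[p (e s) * p F * _]mulrA.
  rewrite [p (e s) * (p F ^+ b' * _)]mulrA.
  have -> : p (e s) * p F ^+ b' = p F ^+ b' * p (e s).
    by apply: commrX; rewrite /GRing.comm pFe.
  by rewrite -!mulrA.
apply: weight_eq (weightM (weightM (weightM (wt_up Lu') (nu_wte rel s))
  (wt_low (lmonX f F b'.+1))) (nu_wte rel r)) _.
by rewrite -eb' eb ea' -!natr1; ring.
Qed.

Let chi_mul_E y : wt (- 2) y -> chi (y * E) = 0.
Proof.
move=> wy; apply: (chi_mul_right (nu_wtE rel) wy) => u v a b Lu Lv.
rewrite -natrD => /eqP; rewrite eqr_nat addn2 => /eqP eb.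
have FE0 z : wt 0 z -> chi (z * (F * E)) = 0.
  by move=> wz; rewrite (chiM chr) // (chi_FE r0) mulr0.
have [[b' [s [v' [eb' Lv' ->]]]]|[[|b'] [eb' ->]]] := lmon_split (nu_Ff rel) Lv.
- have [[b0 _]|[b2 [q [v2 [eb2 Lv2 ->]]]]|[b2 [v2 [eb2 Lv2 ->]]]] := lmon_last Lv'.
  + by move: eb; rewrite eb' b0.
  + have -> : u * (v2 * f q * f s) * E = u * v2 * (f q * f s * E) by rewrite !mulrA.
    rewrite (chiM chr) ?chi_ffE ?mulr0 //; apply: (wt_ud Lu Lv2).
    by move: eb; rewrite eb' eb2 => -[->]; rewrite subrr.
  + rewrite -[v2 * F * f s]mulrA (nu_Ff rel).
    have -> : u * (v2 * (f s * F)) * E = u * (v2 * f s) * (F * E) by rewrite !mulrA.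
    apply: FE0; apply: (wt_ud Lu (lmon_gr s Lv2)).
    by move: eb; rewrite eb' eb2 => -[->]; rewrite subrr.
- by rewrite eb in eb'.
rewrite exprSr.
have -> : u * (F ^+ b' * F) * E = u * F ^+ b' * (F * E) by rewrite !mulrA.
apply: FE0; apply: (wt_ud Lu (lmonX f F b')).
by move: eb; rewrite eb' doubleS => -[->]; rewrite subrr.
Qed.

Lemma chi_low_up a x y : (0 < a)%N -> lmon f F a x -> lmon e E a y -> chi (x * y) = 0.
Proof.
move=> a0 Lx Ly.
have [[ea _]|[b [r [z [ea Lz ->]]]]|[b [z [ea Lz ->]]]] := lmon_last Ly.
- by rewrite ea in a0.
- rewrite mulrA; apply: chi_mul_e.
  apply: weight_eq (weightM (wt_low Lx) (wt_up Lz)) _; rewrite ea -natr1; ring.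
- rewrite mulrA; apply: chi_mul_E.
  apply: weight_eq (weightM (wt_low Lx) (wt_up Lz)) _; rewrite ea -addn2 natrD; ring.
Qed.

End Fixed.
End Characters.

(** * Commutators and the tilde relations *)
Section Commutator.
Variables (K : comNzRingType) (A : algType K).
Implicit Types x y z : A.

Definition lie x y := x * y - y * x.

Lemma lieC x y : lie x y = - lie y x.
Proof. by rewrite /lie opprB. Qed.
Lemma liexx x : lie x x = 0.
Proof. exact: subrr. Qed.
Lemma lieDr x y z : lie x (y + z) = lie x y + lie x z.
Proof. by rewrite /lie mulrDr mulrDl opprD addrACA. Qed.
Lemma lieDl x y z : lie (y + z) x = lie y x + lie z x.
Proof. by rewrite lieC lieDr opprD -!lieC. Qed.
Lemma lieZr a x y : lie x (a *: y) = a *: lie x y.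
Proof. by rewrite /lie -scalerAr -scalerAl scalerBr. Qed.
Lemma lieZl a x y : lie (a *: x) y = a *: lie x y.
Proof. by rewrite lieC lieZr -scalerN -lieC. Qed.
Lemma lieNr x y : lie x (- y) = - lie x y.
Proof. by rewrite -scaleN1r lieZr scaleN1r. Qed.
Lemma lieNl x y : lie (- x) y = - lie x y.
Proof. by rewrite -scaleN1r lieZl scaleN1r. Qed.
Lemma lie_sumr n (F : 'I_n -> A) x : lie x (\sum_r F r) = \sum_r lie x (F r).
Proof. by rewrite /lie mulr_sumr mulr_suml sumrB. Qed.
Lemma lie_suml n (F : 'I_n -> A) x : lie (\sum_r F r) x = \sum_r lie (F r) x.
Proof. by rewrite /lie mulr_sumr mulr_suml sumrB. Qed.
Lemma lieMr x y z : lie x (y * z) = lie x y * z + y * lie x z.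
Proof. by rewrite /lie mulrBl mulrBr !mulrA addrA subrK. Qed.
Lemma lieMl x y z : lie (y * z) x = lie y x * z + y * lie z x.
Proof. by rewrite lieC lieMr [lie x y]lieC [lie x z]lieC mulNr mulrN -opprD opprK. Qed.
Lemma lie_scalar x a : lie x a%:A = 0.
Proof. by rewrite /lie mulr_algl mulr_algr subrr. Qed.
Lemma lie_1l x : lie 1 x = 0.
Proof. by rewrite /lie mul1r mulr1 subrr. Qed.
Lemma lie0E x y : lie x y = 0 -> x * y = y * x.
Proof. by move/eqP; rewrite subr_eq0 => /eqP. Qed.
Lemma lie0_intro x y : x * y = y * x -> lie x y = 0.
Proof. by rewrite /lie => ->; apply: subrr. Qed.

End Commutator.

Definition lieE := (lieDr, lieDl, lieZr, lieZl, lieNr, lieNl).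

Section TildeRelations.
Variables (C : numFieldType) (A : algType C) (N : nat).

Record tilde_rel (H E F : A) (e f : 'I_N -> A) (Z : 'I_N -> 'I_N -> A) : Prop :=
 TildeRel {
  t_HE : lie H E = 2 *: E;
  t_HF : lie H F = - 2 *: F;
  t_He : forall r, lie H (e r) = e r;
  t_Hf : forall r, lie H (f r) = - f r;
  t_EF : lie E F = H;
  t_Ee : forall r, lie E (e r) = 0;
  t_Ef : forall r, lie E (f r) = - e r;
  t_Fe : forall r, lie F (e r) = - f r;
  t_Ff : forall r, lie F (f r) = 0;
  t_ee : forall r s, lie (e r) (e s) = 0;
  t_ff : forall r s, lie (f r) (f s) = 0;
  t_ef : forall r s, lie (e r) (f s) = - 2 *: Z r s;
  t_HZ : forall r s, lie H (Z r s) = 0;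
  t_EZ : forall r s, lie E (Z r s) = 0;
  t_FZ : forall r s, lie F (Z r s) = 0;
  t_eZ : forall i r s, lie (e i) (Z r s) = 0;
  t_fZ : forall i r s, lie (f i) (Z r s) = 0;
  t_ZZ : forall p q r s, lie (Z p q) (Z r s) = 0
}.

Variables (H E F : A) (e f : 'I_N -> A) (Z : 'I_N -> 'I_N -> A).
Hypothesis rel : tilde_rel H E F e f Z.

(** This automorphism of the Jacobi algebra exchanges raising and lowering
    operators; it halves the verifications below and produces the lowest weight
    module from the highest weight one. *)
Lemma tilde_rel_flip :
  tilde_rel (- H) (- F) (- E) f (fun r => - e r) (fun r s => Z s r).
Proof.
case: rel => HE HF He Hf EF Ee Ef Fe Ff ee ff ef HZ EZ FZ eZ fZ ZZ.
split=> *; rewrite ?lieNl ?lieNr ?(HE, HF, He, Hf, Ee, Fe, Ff, ee, ff, HZ, EZ, FZ, eZ, fZ, ZZ);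
  rewrite ?opprK ?oppr0 //.
- by rewrite scaleNr scalerN.
- by rewrite scaleNr scalerN opprK.
- by rewrite lieC EF.
- by rewrite Ef opprK.
- by rewrite -lieC ef.
Qed.

Definition E_nu := E + 2^-1 *: \sum_(r < N) e r ^+ 2.
Definition F_nu := F - 2^-1 *: \sum_(r < N) f r ^+ 2.

Variables (J : twoSidedIdeal A) (S : set A).
Hypothesis JZ : forall r s, Z r s + (2^-1 * (r == s)%:R)%:A \in J.
Hypothesis SZ : forall z, S z -> exists r s, z = Z r s.

Let J2 r s : 2 *: Z r s + (r == s)%:R%:A \in J.
Proof.
have -> : 2 *: Z r s + (r == s)%:R%:A = 2%:A * (Z r s + (2^-1 * (r == s)%:R)%:A).
  by rewrite mulr_algl; lin_field C.
by apply: two_sidedMl; apply: JZ.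
Qed.

Let lie_ef r s : lie (e r) (f s) - (1 * (r == s)%:R)%:A \in J.
Proof.
rewrite (t_ef rel).
have -> : - 2 *: Z r s - (1 * (r == s)%:R)%:A = - (2 *: Z r s + (r == s)%:R%:A).
  by lin_ring C.
by rewrite rpredN.
Qed.

Let lie_sql (x y : A) : lie (x ^+ 2) y = lie x y * x + x * lie x y.
Proof. by rewrite expr2 lieMl. Qed.
Let lie_sqr (x y : A) : lie y (x ^+ 2) = lie y x * x + x * lie y x.
Proof. by rewrite expr2 lieMr. Qed.

Let lie_Enu_f s : lie E_nu (f s) \in J.
Proof.
rewrite /E_nu lieDl lieZl (t_Ef rel) lie_suml.
have -> : 2^-1 *: (\sum_r lie (e r ^+ 2) (f s)) = - (\sum_r (2 *: Z r s) * e r).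
  rewrite scaler_sumr -sumrN; apply: eq_bigr => r _.
  rewrite lie_sql (t_ef rel) -scalerAr (lie0E (t_eZ rel r r s)) -!scalerAl.
  by lin_field C.
have -> : - e s = - \sum_r (r == s)%:R%:A * e r.
  rewrite (bigD1 s) //= eqxx scale1r mul1r big1 ?addr0 // => r /negPf->.
  by rewrite scale0r mul0r.
rewrite -opprD rpredN -big_split; apply: rpred_sum => r _ /=.
by rewrite -mulrDl addrC; apply: two_sidedMr; apply: J2.
Qed.

Let lie_Enu_e s : lie E_nu (e s) = 0.
Proof.
rewrite /E_nu lieDl lieZl (t_Ee rel) lie_suml big1 ?scaler0 ?addr0 // => r _.
by rewrite lie_sql (t_ee rel) mul0r mulr0 addr0.
Qed.

Let lie_Enu_Fnu : lie E_nu F_nu - (H + 1 *: (\sum_r f r * e r) + (2^-1 * N%:R)%:A) \in J.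
Proof.
rewrite /F_nu lieDr lieNr lieZr lie_sumr.
have -> : lie E_nu F = H + \sum_r f r * e r - \sum_r Z r r.
  rewrite /E_nu lieDl lieZl (t_EF rel) lie_suml -addrA -sumrB; congr (_ + _).
  rewrite scaler_sumr; apply: eq_bigr => r _.
  rewrite lie_sql lieC (t_Fe rel) opprK.
  have -> : e r * f r = f r * e r + - 2 *: Z r r.
    by rewrite -(t_ef rel) /lie addrC subrK.
  by lin_field C.
have eN : (2^-1 * N%:R)%:A = \sum_(r < N) (2^-1 * (r == r)%:R)%:A :> A.
  under eq_bigr do rewrite eqxx mulr1.
  by rewrite sumr_const card_ord -scaler_nat scalerA mulrC.
set X := \sum_r f r * e r; set Y := \sum_r lie _ _.
have -> : H + X - \sum_r Z r r - 2^-1 *: Y - (H + 1 *: X + (2^-1 * N%:R)%:A) =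
  - (\sum_r Z r r + (2^-1 * N%:R)%:A + 2^-1 *: Y) by lin_ring C.
rewrite rpredN; apply: rpredD.
  by rewrite eN -big_split; apply: rpred_sum => r _; apply: JZ.
rewrite -mulr_algl; apply/two_sidedMl/rpred_sum => r _; rewrite lie_sqr.
by apply: rpredD; [apply: two_sidedMr|apply: two_sidedMl]; apply: lie_Enu_f.
Qed.

Let sum_wt d (g : 'I_N -> A) : (forall r, weight H S d (g r)) ->
  weight H S (d *+ 2) (\sum_r g r ^+ 2).
Proof. by move=> wg; apply: weight_sum => r; apply: weightX. Qed.

Let wt d x : lie H x = d *: x -> (forall r s, lie x (Z r s) = 0) -> weight H S d x.
Proof. by move=> hx zx; split=> // z /SZ[r [s ->]]; rewrite (lie0E (zx r s)). Qed.

(** The relations in which the raising letters play the main part; the others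
    follow by [tilde_rel_flip]. *)
Lemma tilde_nu_half :
  [/\ weight H S 2 E_nu, forall r, weight H S 1 (e r),
     forall r, E_nu * e r = e r * E_nu, forall r, lie E_nu (f r) \in J
   & lie E_nu F_nu - (H + 1 *: (\sum_r f r * e r) + (2^-1 * N%:R)%:A) \in J].
Proof.
have we r : weight H S 1 (e r).
  by apply: wt => [|p q]; rewrite ?scale1r ?(t_He rel) ?(t_eZ rel).
split=> // [|r]; last exact: lie0E.
apply: weightD; first by apply: wt => [|p q]; rewrite ?(t_HE rel) ?(t_EZ rel).
exact/weightZ/sum_wt.
Qed.

End TildeRelations.

Section NuOfTilde.
Variables (C : numFieldType) (A : algType C) (N : nat).
Variables (H E F : A) (e f : 'I_N -> A) (Z : 'I_N -> 'I_N -> A).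
Variables (J : twoSidedIdeal A) (S : set A).
Hypothesis rel : tilde_rel H E F e f Z.
Hypothesis JZ : forall r s, Z r s + (2^-1 * (r == s)%:R)%:A \in J.
Hypothesis SZ : forall z, S z -> exists r s, z = Z r s.

Lemma tilde_nu_rel : nu_rel J S 1 (2^-1 * N%:R) H (E_nu E e) (F_nu F f) e f.
Proof.
have [wE we Ee Ef EF] := tilde_nu_half rel JZ SZ.
have flip := tilde_rel_flip rel.
have EnuF : E_nu (- F) f = - F_nu F f by rewrite /E_nu /F_nu opprB addrC.
have [|| + wf + + _] := tilde_nu_half (J := J) (S := S) flip.
- by move=> r s; rewrite eq_sym.
- by move=> z /SZ[r [s ->]]; exists s, r.
rewrite EnuF => wF Ff Fe.
have sgn d x : weight (- H) S d x -> weight H S (- d) x.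
  by move=> /weightNl; rewrite opprK.
split=> //.
- by rewrite -[F_nu F f]opprK -scaleN1r; apply: weightZ; apply: sgn.
- by move=> r; apply: sgn.
- by move=> r s; apply/lie0E/(t_ee rel).
- by move=> r s; apply/lie0E/(t_ff rel).
- by move=> r; apply: oppr_inj; rewrite -mulNr -mulrN Ff.
- move=> r s; rewrite -/(lie _ _) (t_ef rel) mul1r.
  have -> : - 2 *: Z r s - (r == s)%:R%:A =
     (- 2)%:A * (Z r s + (2^-1 * (r == s)%:R)%:A).
    by rewrite mulr_algl; lin_field C.
  by apply: two_sidedMl; apply: JZ.
- by move=> r; have := Fe r; rewrite lieNl lieNr opprK.
Qed.

End NuOfTilde.

(** Conversely, an sl2 triple commuting with a Weyl algebra yields the tilde
    relations with Z_rs = - delta_rs / 2, by solving for H, E, F in terms of their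
    nu versions. *)
Section TildeOfNu.
Variables (C : numFieldType) (A : algType C) (N : nat).
Variables (h x y : A) (e f : 'I_N -> A).
Hypothesis hx : lie h x = 2 *: x.
Hypothesis hy : lie h y = - 2 *: y.
Hypothesis xy : lie x y = h.
Hypothesis he : forall r, lie h (e r) = 0.
Hypothesis hf : forall r, lie h (f r) = 0.
Hypothesis xe : forall r, lie x (e r) = 0.
Hypothesis xf : forall r, lie x (f r) = 0.
Hypothesis ye : forall r, lie y (e r) = 0.
Hypothesis yf : forall r, lie y (f r) = 0.
Hypothesis ee : forall r s, lie (e r) (e s) = 0.
Hypothesis ff : forall r s, lie (f r) (f s) = 0.
Hypothesis ef : forall r s, lie (e r) (f s) = (r == s)%:R%:A.

Definition H_of_nu : A := h - \sum_r f r * e r - (2^-1 * N%:R)%:A.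
Definition E_of_nu : A := x - 2^-1 *: \sum_r e r ^+ 2.
Definition F_of_nu : A := y + 2^-1 *: \sum_r f r ^+ 2.

Let sum_delta (g : 'I_N -> A) s : \sum_r (r == s)%:R *: g r = g s.
Proof.
rewrite (bigD1 s) //= eqxx scale1r big1 ?addr0 // => r /negPf->.
by rewrite scale0r.
Qed.

Let number_e s : lie (\sum_r f r * e r) (e s) = - e s.
Proof.
rewrite lie_suml -[in RHS](sum_delta e s) -sumrN; apply: eq_bigr => r _.
by rewrite lieMl ee mulr0 addr0 lieC ef mulNr mulr_algl eq_sym.
Qed.

Let number_f s : lie (\sum_r f r * e r) (f s) = f s.
Proof.
rewrite lie_suml -[RHS](sum_delta f s); apply: eq_bigr => r _.
by rewrite lieMl ff mul0r add0r ef mulr_algr.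
Qed.

Let He s : lie H_of_nu (e s) = e s.
Proof.
by rewrite /H_of_nu !lieE number_e he lie_1l; lin_ring C.
Qed.

Let Hf s : lie H_of_nu (f s) = - f s.
Proof.
by rewrite /H_of_nu !lieE number_f hf lie_1l; lin_ring C.
Qed.

Let number0 z : (forall r, lie z (e r) = 0) -> (forall r, lie z (f r) = 0) ->
  lie (\sum_r f r * e r) z = 0.
Proof.
move=> ze zf; rewrite lie_suml big1 // => r _.
by rewrite lieMl [lie (f r) z]lieC [lie (e r) z]lieC ze zf oppr0 mul0r mulr0 addr0.
Qed.

Let Hx : lie H_of_nu x = 2 *: x.
Proof.
by rewrite /H_of_nu !lieE (number0 xe xf) hx lie_1l; lin_ring C.
Qed.

Let Hy : lie H_of_nu y = - 2 *: y.
Proof.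
by rewrite /H_of_nu !lieE (number0 ye yf) hy lie_1l; lin_ring C.
Qed.

Let lie_sq (g : 'I_N -> A) z w a :
  (forall r, lie z (g r) = a r *: w r) -> (forall r, w r * g r = g r * w r) ->
  2^-1 *: lie z (\sum_r g r ^+ 2) = \sum_r a r *: (g r * w r).
Proof.
move=> zg wg; rewrite lie_sumr scaler_sumr; apply: eq_bigr => r _.
by rewrite expr2 lieMr zg -scalerAl wg -scalerAr; lin_field C.
Qed.

Let sq0 (g : 'I_N -> A) z : (forall r, lie z (g r) = 0) -> lie z (\sum_r g r ^+ 2) = 0.
Proof. by move=> zg; rewrite lie_sumr big1 // => r _; rewrite expr2 lieMr zg mul0r mulr0 addr0. Qed.

Let Hsq (g : 'I_N -> A) a : (forall r, lie H_of_nu (g r) = a *: g r) ->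
  lie H_of_nu (\sum_r g r ^+ 2) = (2 * a) *: \sum_r g r ^+ 2.
Proof.
move=> Hg; rewrite lie_sumr scaler_sumr; apply: eq_bigr => r _.
by rewrite expr2 lieMr Hg -scalerAl -scalerAr; lin_ring C.
Qed.

Let sq_e_f s : lie (2^-1 *: \sum_r e r ^+ 2) (f s) = e s.
Proof.
rewrite lieC lieZr (@lie_sq e _ (fun=> 1) (fun r => - (r == s)%:R)).
- rewrite -sumrN -[RHS]sum_delta; apply: eq_bigr => r _.
  by rewrite mulr1 scaleNr opprK.
- by move=> r; rewrite lieC ef scaleNr.
- by move=> r; rewrite mulr1 mul1r.
Qed.

Let sq_f_e s : lie (2^-1 *: \sum_r f r ^+ 2) (e s) = - f s.
Proof.
rewrite lieC lieZr (@lie_sq f _ (fun=> 1) (fun r => (r == s)%:R)).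
- by congr (- _); rewrite -[RHS]sum_delta; apply: eq_bigr => r _; rewrite mulr1.
- by move=> r; rewrite ef eq_sym.
- by move=> r; rewrite mulr1 mul1r.
Qed.

Let sq_e_sq_f : lie (2^-1 *: \sum_r e r ^+ 2) (2^-1 *: \sum_r f r ^+ 2) =
  \sum_r f r * e r + (2^-1 * N%:R)%:A.
Proof.
set q := 2^-1 *: _; rewrite lieZr lie_sumr scaler_sumr.
have -> : (2^-1 * N%:R)%:A = \sum_(r < N) 2^-1%:A :> A.
  by rewrite sumr_const card_ord -scaler_nat scalerA mulrC.
rewrite -big_split; apply: eq_bigr => r _ /=.
rewrite expr2 lieMr sq_e_f.
have -> : e r * f r = f r * e r + 1.
  by have := ef r r; rewrite eqxx scale1r => <-; rewrite /lie addrC subrK.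
by lin_field C.
Qed.

Lemma tilde_rel_of_nu :
  tilde_rel H_of_nu E_of_nu F_of_nu e f (fun r s => (- (2^-1 * (r == s)%:R))%:A).
Proof.
split=> *; rewrite ?lie_scalar //.
- rewrite /E_of_nu lieDr lieNr lieZr Hx (@Hsq e 1) => [|r]; last by rewrite scale1r.
  by lin_ring C.
- rewrite /F_of_nu lieDr lieZr Hy (@Hsq f (- 1)) => [|r]; last by rewrite scaleN1r.
  by lin_ring C.
- rewrite /E_of_nu /F_of_nu lieDl !lieDr xy lieNl [lie (- _) (2^-1 *: _)]lieNl sq_e_sq_f.
  rewrite lieZr sq0 // lieZl [lie _ y]lieC sq0 // /H_of_nu; by lin_ring C.
- by rewrite /E_of_nu lieDl xe lieNl lieZl lieC sq0 // scalerN scaler0 !oppr0 addr0.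
- by rewrite /E_of_nu lieDl xf lieNl sq_e_f add0r.
- by rewrite /F_of_nu lieDl ye sq_f_e add0r.
- by rewrite /F_of_nu lieDl yf lieZl lieC sq0 // scalerN scaler0 oppr0 addr0.
- by rewrite ef; lin_field C.
Qed.

End TildeOfNu.

(** * The tilde basis of the Jacobi algebra *)
Section TildeBasis.
Variables (C : numClosedFieldType) (N : nat).
Local Notation br := (@jbracket C N).

Lemma jZC (r s : 'I_N) : jZ C r s = jZ C s r.
Proof.
have e : sort_pair r s = sort_pair s r.
  by rewrite /sort_pair; case: ltngtP => // /val_inj->.
by rewrite /jZ; congr (jvec _ (BZ _)); apply: val_inj; rewrite /= e.
Qed.

Let sqri : 'i ^+ 2 = -1 :> C.
Proof. by rewrite sqrCi. Qed.

Lemma jbracket_Zt (x : jacobi C N) r s : br x (jZt C r s) = 0.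
Proof. by rewrite /jZt jbracketZr jbracket_central scaler0. Qed.

Let brE := (@jbracketDl C N, @jbracketDr C N, @jbracketNl C N, @jbracketNr C N, @jbracketZl C N, @jbracketZr C N).

Ltac lin_i := linear_over C; do ?[split]; first [done | by field: sqri].
Ltac tilde := rewrite /jHt /jEt /jFt /jet /jft /jZt !brE !jbracket_vec /jtable /=; lin_i.

Lemma jEtFt : br (jEt C N) (jFt C N) = jHt C N.
Proof. tilde. Qed.
Lemma jEtet r : br (jEt C N) (jet C r) = 0.
Proof. tilde. Qed.
Lemma jEtft r : br (jEt C N) (jft C r) = - jet C r.
Proof. tilde. Qed.
Lemma jFtet r : br (jFt C N) (jet C r) = - jft C r.
Proof. tilde. Qed.
Lemma jFtft r : br (jFt C N) (jft C r) = 0.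
Proof. tilde. Qed.
Lemma jetet r s : br (jet C r) (jet C s) = 0.
Proof. rewrite /jet !brE !jbracket_vec /jtable /= [jZ C s r]jZC; lin_i. Qed.
Lemma jftft r s : br (jft C r) (jft C s) = 0.
Proof. rewrite /jft !brE !jbracket_vec /jtable /= [jZ C s r]jZC; lin_i. Qed.
Lemma jetft r s : br (jet C r) (jft C s) = - 2 *: jZt C r s.
Proof. rewrite /jet /jft /jZt !brE !jbracket_vec /jtable /= [jZ C s r]jZC; lin_i. Qed.

(** The tilde vectors span: each vector of the original basis is a combination of
    them. *)
Lemma tilde_ind (P : jacobi C N -> Prop) :
  (forall a x y, P x -> P y -> P (a *: x + y)) ->
  P (jHt C N) -> P (jEt C N) -> P (jFt C N) -> (forall r, P (jet C r)) ->
  (forall r, P (jft C r)) -> (forall r s, P (jZt C r s)) -> forall x, P x.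
Proof.
move=> Plin PH PE PF Pe Pf PZ.
have P0 : P 0 by rewrite -[0](addNr (jHt C N)) -scaleN1r; apply: Plin.
have PZr a x : P x -> P (a *: x) by move=> Px; rewrite -[a *: x]addr0; apply: Plin.
have PD x y : P x -> P y -> P (x + y) by move=> Px; rewrite -[x]scale1r; apply: Plin.
have Pb b : P (jvec C b).
  case: b => [|||r|r|q].
  - have -> : jvec C BE = (2^-1 * 'i) *: (jHt C N + (- 1) *: jEt C N + jFt C N).
      by rewrite /jHt /jEt /jFt /jE /jF /jH; lin_i.
    exact: (PZr _ _ (PD _ _ (PD _ _ PH (PZr _ _ PE)) PF)).
  - have -> : jvec C BF = (- 2^-1 * 'i) *: (jHt C N + jEt C N + (- 1) *: jFt C N).
      by rewrite /jHt /jEt /jFt /jE /jF /jH; lin_i.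
    exact: (PZr _ _ (PD _ _ (PD _ _ PH PE) (PZr _ _ PF))).
  - have -> : jvec C BH = jEt C N + jFt C N.
      by rewrite /jEt /jFt /jE /jF /jH; lin_i.
    exact: PD.
  - have -> : jvec C (Be r) = (- 'i) *: (jet C r + (- 1) *: jft C r).
      by rewrite /jet /jft /je /jf; lin_i.
    exact: (PZr _ _ (PD _ _ (Pe r) (PZr _ _ (Pf r)))).
  - have -> : jvec C (Bf r) = jet C r + jft C r.
      by rewrite /jet /jft /je /jf; lin_i.
    exact: PD.
  - have -> : jvec C (BZ q) = (- 2 * 'i) *: jZt C (val q).1 (val q).2.
      have -> : jvec C (BZ q) = jZ C (val q).1 (val q).2.
        rewrite /jZ; congr (jvec _ (BZ _)); apply: val_inj => /=.
        by rewrite /sort_pair (valP q); case: (val q).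
      by rewrite /jZt; lin_i.
    exact: PZr.
move=> x; have -> : x = \sum_b x b *: jvec C b.
  apply/ffunP => b; rewrite sum_ffunE (bigD1 b) //= big1 ?addr0 => [|c /negPf ncb].
    by rewrite ffunE jvecE eqxx; symmetry; apply: mulr1.
  by rewrite ffunE jvecE eq_sym ncb; apply: mulr0.
by elim/big_ind: _ => // b _; apply: PZr.
Qed.

End TildeBasis.

(** * The enveloping algebra of the Jacobi algebra *)
Lemma free_word_cons (K : comNzRingType) (L : choiceType) (x : L) (w : word L) :
  mkmalgU (x :: w : word L) 1 = free_gen K x * mkmalgU w 1 :> free_algebra K L.
Proof.
transitivity (fgmul (free_gen K x) (mkmalgU w 1)).
  by rewrite /free_gen fgmulUU mulr1.
exact/esym/malgM_def.
Qed.

Lemma free_word_scale (K : comNzRingType) (L : choiceType) (a : K) (w : word L) :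
  mkmalgU w a = a *: (mkmalgU w 1 : free_algebra K L).
Proof.
apply/malgP => v; transitivity (a * monalg.mcoeff v (mkmalgU w (1 : K))).
  by rewrite !monalg.mcoeffU; case: eqP; rewrite ?mulr1 ?mulr0.
exact/esym/monalg.mcoeffZ.
Qed.

Section Envelope.
Variables (C : numClosedFieldType) (N : nat).
Local Notation U := (jU C N).
Local Notation jin := (@jin C N).

Lemma jin_lie x y : lie (jin x) (jin y) = jin (jbracket x y).
Proof. exact/esym/env_in_bracket. Qed.

Lemma jinZ a x : jin (a *: x) = a *: jin x.
Proof. exact: linearZ. Qed.
Lemma jinN x : jin (- x) = - jin x.
Proof. exact: linearN. Qed.
Lemma jin0 : jin 0 = 0.
Proof. exact: linear0. Qed.
Lemma jinP a x y : jin (a *: x + y) = a *: jin x + jin y.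
Proof. exact: linearP. Qed.

Definition jZs : set U := [set u | exists r s, u = jin (jZt C r s)].
Definition jJgen : set U :=
  [set u | exists r s, u = jin (jZt C r s) + (2^-1 * (r == s)%:R)%:A].
Local Notation J := (ideal_pred jJgen).

Lemma jU_tilde_rel : tilde_rel (jin (jHt C N)) (jin (jEt C N)) (jin (jFt C N))
  (fun r => jin (jet C r)) (fun r => jin (jft C r)) (fun r s => jin (jZt C r s)).
Proof.
split=> [||r|r||r|r|r|r|r s|r s|r s|r s|r s|r s|i r s|i r s|i j r s]; rewrite jin_lie.
- by rewrite jHtEt jinZ.
- by rewrite jHtFt jinZ.
- by rewrite jHtet.
- by rewrite jHtft jinN.
- by rewrite jEtFt.
- by rewrite jEtet jin0.
- by rewrite jEtft jinN.
- by rewrite jFtet jinN.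
- by rewrite jFtft jin0.
- by rewrite jetet jin0.
- by rewrite jftft jin0.
- by rewrite jetft jinZ.
- by rewrite jbracket_Zt jin0.
- by rewrite jbracket_Zt jin0.
- by rewrite jbracket_Zt jin0.
- by rewrite jbracket_Zt jin0.
- by rewrite jbracket_Zt jin0.
- by rewrite jbracket_Zt jin0.
Qed.

Lemma jU_nu_rel : nu_rel J jZs 1 (2^-1 * N%:R) (jin (jHt C N)) (jEnu C N) (jFnu C N)
  (fun r => jin (jet C r)) (fun r => jin (jft C r)).
Proof.
apply: tilde_nu_rel jU_tilde_rel _ _ => // r s.
by apply/asboolP/ideal_gen; exists r, s.
Qed.

Lemma jU_ind (P : U -> Prop) : P 1 ->
  (forall a u v, P u -> P v -> P (a *: u + v)) ->
  (forall x u, P u -> P (jin x * u)) -> forall u, P u.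
Proof.
move=> P1 Plin Pin.
have P0 : P 0 by rewrite -[0](addNr 1) -scaleN1r; apply: Plin.
pose pi := @aq_pi C (free_algebra C (jacobi C N)) (ideal_pred (env_rel (@jbracket C N))).
have Pw (w : seq (jacobi C N)) : P (pi (mkmalgU (w : word _) 1)).
  elim: w => [|x w IH].
    have e1 : mkmalgU ([::] : word (jacobi C N)) 1 = 1 :> free_algebra C _ by [].
    rewrite e1.
    have -> : pi 1 = 1 by rewrite /pi rmorph1.
    exact: P1.
  by rewrite free_word_cons /pi rmorphM; apply: (Pin x).
have piP a x y : pi (a *: x + y) = a *: pi x + pi y by rewrite /pi linearP.
have Plin' a x y : P (pi x) -> P (pi y) -> P (pi (a *: x + y)).
  by move=> Px Py; rewrite piP; apply: (Plin a _ _ Px Py).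
have pi0 : P (pi 0) by rewrite /pi raddf0; apply: P0.
have Ppi (g : free_algebra C (jacobi C N)) : P (pi g).
  rewrite [g]monalgE.
  apply: (big_ind (fun g => P (pi g))) => // [v w Pv Pw'|w _].
    by rewrite -[v]scale1r; apply: Plin'.
  rewrite free_word_scale -[_ *: _]addr0.
  by apply: Plin' => //; apply: Pw.
by move=> u; rewrite -[u]aq_reprK; apply: Ppi.
Qed.

End Envelope.

(** The words of letters are, up to reordering, the monomials with exponents that
    define the ideals of the two characters. *)
Section PowerMonomials.
Variables (A : pzRingType) (n : nat) (g : 'I_n -> A) (G : A).

Definition powmon (i : nat) (I : {ffun 'I_n -> nat}) : A := G ^+ i * \prod_r g r ^+ I r.

Lemma lmonM a b x y : lmon g G a x -> lmon g G b y -> lmon g G (a + b)%N (x * y).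
Proof.
move=> + Ly; elim=> [|r c z _ IH|c z _ IH]; first by rewrite mul1r.
- by rewrite -mulrA; apply: Lmon_g.
- by rewrite -mulrA; apply: Lmon_G.
Qed.

Lemma lmon_powmon i (I : {ffun 'I_n -> nat}) : lmon g G (2 * i + \sum_r I r) (powmon i I).
Proof.
apply: lmonM; first by rewrite mul2n; apply: lmonX.
elim/big_ind2: _ => [|a x b y|r _]; [exact: Lmon1|exact: lmonM|].
elim: (I r) => [|m IH]; first exact: Lmon1.
by rewrite exprS; apply: Lmon_g.
Qed.

Hypothesis gg : forall r s, g r * g s = g s * g r.
Hypothesis Gg : forall r, G * g r = g r * G.

Let prodM (x y : 'I_n -> A) : (forall r s, x r * y s = y s * x r) ->
  (\prod_r x r) * (\prod_r y r) = \prod_r (x r * y r).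
Proof.
move=> xy; elim: (index_enum _) => [|r l IH]; first by rewrite !big_nil mulr1.
rewrite !big_cons -IH -!mulrA; congr (x r * _); rewrite !mulrA; congr (_ * _).
by elim: (l) => [|s m IHm]; rewrite ?big_nil ?mul1r ?mulr1 // big_cons -mulrA IHm !mulrA xy.
Qed.

Lemma lmonP a x : lmon g G a x ->
  exists i (I : {ffun 'I_n -> nat}), (2 * i + \sum_r I r)%N = a /\ x = powmon i I.
Proof.
elim=> [|s b y _ [i [I [<- ->]]]|b y _ [i [I [<- ->]]]].
- exists 0%N, [ffun=> 0%N]; rewrite /powmon mul1r; split.
    by rewrite big1 // => r _; rewrite ffunE.
  by rewrite big1 // => r _; rewrite ffunE.
- exists i, [ffun r => (r == s) + I r]%N; split.
    rewrite (eq_bigr (fun r => (r == s) + I r)%N) => [|r _]; last by rewrite ffunE.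
    rewrite big_split /= (bigD1 s) //= eqxx big1 ?addn0; last by move=> r /negPf->.
    by rewrite add1n addnS.
  rewrite /powmon mulrA; have -> : g s * G ^+ i = G ^+ i * g s.
    by apply: commrX; rewrite /GRing.comm Gg.
  rewrite -mulrA; congr (_ * _).
  transitivity ((\prod_r g r ^+ (r == s)) * \prod_r g r ^+ I r).
    congr (_ * _); rewrite (eq_bigr (fun r => if r == s then g s else 1)).
      by rewrite -big_mkcond big_pred1_eq.
    by move=> r _; case: eqP => [->|_].
  rewrite prodM; first by apply: eq_bigr => r _; rewrite ffunE exprD.
  move=> r t; apply: commrX; apply/commr_sym/commrX; rewrite /GRing.comm gg //.
- by exists i.+1, I; split; [rewrite mulnS -addnA|rewrite /powmon exprS mulrA].
Qed.

End PowerMonomials.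

Section Jacobi.
Variables (C : numClosedFieldType) (N : nat).
Local Notation U := (jU C N).
Local Notation jin := (@jin C N).
Local Notation H := (jin (jHt C N)).
Local Notation e := (fun r => jin (jet C r)).
Local Notation f := (fun r => jin (jft C r)).
Local Notation J := (ideal_pred (@jJgen C N)).
Local Notation E := (jEnu C N).
Local Notation F := (jFnu C N).

Lemma jZt_central r s (u : U) : jin (jZt C r s) * u = u * jin (jZt C r s).
Proof.
elim/jU_ind: u => [|a u v IHu IHv|x u IHu].
- by rewrite mul1r mulr1.
- by rewrite mulrDr mulrDl -scalerAl -scalerAr IHu IHv.
- apply: commrM; last exact: IHu. apply/esym/lie0E.
  by rewrite jin_lie jbracket_Zt jin0.
Qed.

Lemma jU_left_generated : left_generated J H E F e f.
Proof.
move=> Q Q1 Qlin QJ QHEF Qef.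
have Q0 : Q 0 by apply: QJ; apply: rpred0.
have QD x y : Q x -> Q y -> Q (x + y) by move=> Qx; rewrite -[x]scale1r; apply: Qlin.
have QZ a x : Q x -> Q (a *: x) by move=> Qx; rewrite -[a *: x]addr0; apply: Qlin.
have QN x : Q x -> Q (- x) by move=> Qx; rewrite -scaleN1r; apply: QZ.
have Qsq (g : 'I_N -> U) u : (forall r v, Q v -> Q (g r * v)) -> Q u ->
    Q ((2^-1 *: \sum_r g r ^+ 2) * u).
  move=> Qg Qu; rewrite -scalerAl; apply: QZ; rewrite mulr_suml.
  by apply: (big_ind Q) => // r _; rewrite expr2 -mulrA; apply: (Qg); apply: Qg.
apply: jU_ind => // x; elim/tilde_ind: x => [a x y Qx Qy u Qu|u Qu|u Qu|u Qu|r u Qu|r u Qu|r s u Qu].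
- by rewrite jinP mulrDl -scalerAl; apply: Qlin; [apply: Qx|apply: Qy].
- by have [QH _ _] := QHEF u Qu.
- have [_ QE _] := QHEF u Qu.
  have -> : jin (jEt C N) = E - 2^-1 *: \sum_r e r ^+ 2 by rewrite /jEnu addrK.
  rewrite mulrBl; apply: (QD _ _ QE).
  apply: QN; apply: Qsq Qu => r v Qv; exact: (Qef r v Qv).1.
- have [_ _ QF] := QHEF u Qu.
  have -> : jin (jFt C N) = F + 2^-1 *: \sum_r f r ^+ 2 by rewrite /jFnu subrK.
  rewrite mulrDl; apply: (QD _ _ QF).
  apply: Qsq Qu => r v Qv; exact: (Qef r v Qv).2.
- exact: (Qef r u Qu).1.
- exact: (Qef r u Qu).2.
- have -> : jin (jZt C r s) * u = (jin (jZt C r s) + (2^-1 * (r == s)%:R)%:A) * u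
      - (2^-1 * (r == s)%:R) *: u by rewrite mulrDl mulr_algl addrK.
  apply: QD; last by apply/QN/QZ.
  by apply: QJ; apply: two_sidedMr; apply/asboolP/ideal_gen; exists r, s.
Qed.

(** As the Z_rs are central, the left ideal that their translates generate is
    two-sided. *)
Lemma jI_kideal k u : jI k u <-> kideal J H k u.
Proof.
split; elim=> [|a g x Gg _ IH]; try exact: LIdeal0.
  apply: LIdealD => //; case: Gg => [->|[r [s ->]]]; [by left|right].
  by apply/asboolP/ideal_gen; exists r, s.
apply: left_idealD => //; case: Gg => [->|/asboolP Jg].
  by rewrite -[_ * _]addr0; apply: LIdealD; [left|apply: LIdeal0].
apply: left_idealMl; elim: Jg => [|b h c y [r [s ->]] _ IHy]; first exact: LIdeal0.
have -> : b * (jin (jZt C r s) + (2^-1 * (r == s)%:R)%:A) * c =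
  b * c * (jin (jZt C r s) + (2^-1 * (r == s)%:R)%:A).
  rewrite -!mulrA; congr (b * _).
  by rewrite mulrDl mulrDr jZt_central mulr_algl mulr_algr.
by apply: LIdealD => //; right; exists r, s.
Qed.

Lemma jUk_wt (x : jUk C N) : weight H (@jZs C N) 0 (val x).
Proof.
have /commutantP Cx := valP x.
have gen g : (g = jHt C N \/ exists r s, g = jZt C r s) -> jin g * val x = val x * jin g.
  move=> Gg; apply: Cx; exists g => //.
  by rewrite -[g]addr0 -[g]scale1r; apply: SpanD => //; apply: Span0.
split; first by rewrite gen ?subrr ?scale0r //; left.
by move=> _ [r [s ->]]; apply: gen; right; exists r, s.
Qed.

End Jacobi.

(** * Representations of the enveloping algebra *)

(** The endomorphism algebra is built for polynomial spaces only: they are nonzero,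
    as needed for its unit to differ from 0. *)
Section MpolyEndomorphisms.
Variables (K : comNzRingType) (n : nat).
Local Notation V := {mpoly K[n]}.

Definition mpoly_endo : Type := {f : V -> V | `[< linear f >]}.
HB.instance Definition _ := SubType.on mpoly_endo.
HB.instance Definition _ := [Choice of mpoly_endo by <:].

Implicit Types f g h : mpoly_endo.

Definition endo_of (f : V -> V) (lf : linear f) : mpoly_endo := exist _ f (asboolT lf).
Definition endo_app f : V -> V := val f.

Lemma endo_linear f : linear (endo_app f).
Proof. exact: (asboolW (valP f)). Qed.

Lemma endo_ofE (f : V -> V) (lf : linear f) x : endo_app (endo_of lf) x = f x.
Proof. by []. Qed.

Lemma endoP f g : (forall x, endo_app f x = endo_app g x) -> f = g.
Proof. by move=> efg; apply: val_inj; apply: funext. Qed.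

Lemma endo_appD f x y : endo_app f (x + y) = endo_app f x + endo_app f y.
Proof. by have := endo_linear f 1 x y; rewrite !scale1r. Qed.
Lemma endo_app0 f : endo_app f 0 = 0.
Proof. by apply: (addrI (endo_app f 0)); rewrite -endo_appD !addr0. Qed.
Lemma endo_appZ f a x : endo_app f (a *: x) = a *: endo_app f x.
Proof. by have := endo_linear f a x 0; rewrite endo_app0 !addr0. Qed.

Fact endo_zero_linear : linear (fun _ : V => 0 : V).
Proof. by move=> a x y; rewrite scaler0 addr0. Qed.
Fact endo_opp_linear f : linear (fun x => - endo_app f x).
Proof. by move=> a x y; rewrite endo_linear opprD scalerN. Qed.
Fact endo_add_linear f g : linear (fun x => endo_app f x + endo_app g x).
Proof. by move=> a x y; rewrite !endo_linear scalerDr addrACA. Qed.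
Fact endo_mul_linear f g : linear (fun x => endo_app f (endo_app g x)).
Proof. by move=> a x y; rewrite !endo_linear. Qed.
Fact endo_one_linear : linear (fun x : V => x).
Proof. by []. Qed.
Fact endo_scale_linear c f : linear (fun x => c *: endo_app f x).
Proof. by move=> a x y; rewrite endo_linear scalerDr !scalerA mulrC. Qed.

Definition endo_zero := endo_of endo_zero_linear.
Definition endo_opp f := endo_of (endo_opp_linear f).
Definition endo_add f g := endo_of (endo_add_linear f g).
Definition endo_mul f g := endo_of (endo_mul_linear f g).
Definition endo_one := endo_of endo_one_linear.
Definition endo_scale c f := endo_of (endo_scale_linear c f).

Fact endo_addA : associative endo_add.
Proof. by move=> f g h; apply: endoP => x; rewrite !endo_ofE addrA. Qed.
Fact endo_addC : commutative endo_add.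
Proof. by move=> f g; apply: endoP => x; rewrite !endo_ofE addrC. Qed.
Fact endo_add0 : left_id endo_zero endo_add.
Proof. by move=> f; apply: endoP => x; rewrite !endo_ofE add0r. Qed.
Fact endo_addN : left_inverse endo_zero endo_opp endo_add.
Proof. by move=> f; apply: endoP => x; rewrite !endo_ofE addNr. Qed.
HB.instance Definition _ := GRing.isZmodule.Build mpoly_endo
  endo_addA endo_addC endo_add0 endo_addN.

Fact endo_mulA : associative endo_mul.
Proof. by move=> f g h; apply: endoP. Qed.
Fact endo_mul1 : left_id endo_one endo_mul.
Proof. by move=> f; apply: endoP. Qed.
Fact endo_mulr1 : right_id endo_one endo_mul.
Proof. by move=> f; apply: endoP. Qed.
Fact endo_mulDl : left_distributive endo_mul endo_add.
Proof. by move=> f g h; apply: endoP. Qed.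
Fact endo_mulDr : right_distributive endo_mul endo_add.
Proof. by move=> f g h; apply: endoP => x; rewrite !endo_ofE endo_appD. Qed.
Fact endo_one_neq0 : endo_one != endo_zero.
Proof.
by apply/eqP => /(congr1 (fun f => endo_app f 1)); rewrite !endo_ofE; apply/eqP/oner_neq0.
Qed.
HB.instance Definition _ := GRing.Zmodule_isNzRing.Build mpoly_endo
  endo_mulA endo_mul1 endo_mulr1 endo_mulDl endo_mulDr endo_one_neq0.

Fact endo_scaleA a b f : endo_scale a (endo_scale b f) = endo_scale (a * b) f.
Proof. by apply: endoP => x; rewrite !endo_ofE scalerA. Qed.
Fact endo_scale1 : left_id 1 endo_scale.
Proof. by move=> f; apply: endoP => x; rewrite !endo_ofE scale1r. Qed.
Fact endo_scaleDr : right_distributive endo_scale +%R.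
Proof. by move=> a f g; apply: endoP => x; rewrite !endo_ofE scalerDr. Qed.
Fact endo_scaleDl f : {morph endo_scale^~ f : a b / a + b}.
Proof. by move=> a b; apply: endoP => x; rewrite !endo_ofE scalerDl. Qed.
HB.instance Definition _ := GRing.Zmodule_isLmodule.Build K mpoly_endo
  endo_scaleA endo_scale1 endo_scaleDr endo_scaleDl.

Fact endo_scaleAl c f g : c *: (f * g) = (c *: f) * g.
Proof. by apply: endoP. Qed.
HB.instance Definition _ := GRing.LSemiModule_isLSemiAlgebra.Build K mpoly_endo endo_scaleAl.
Fact endo_scaleAr c f g : c *: (f * g) = f * (c *: g).
Proof. by apply: endoP => x; rewrite !endo_ofE endo_appZ. Qed.
HB.instance Definition _ := GRing.LSemiAlgebra_isSemiAlgebra.Build K mpoly_endo endo_scaleAr.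

Lemma endo_addE f g x : endo_app (f + g) x = endo_app f x + endo_app g x.
Proof. by []. Qed.
Lemma endo_mulE f g x : endo_app (f * g) x = endo_app f (endo_app g x).
Proof. by []. Qed.
Lemma endo_oppE f x : endo_app (- f) x = - endo_app f x.
Proof. by []. Qed.
Lemma endo_scaleE c f x : endo_app (c *: f) x = c *: endo_app f x.
Proof. by []. Qed.
Lemma endo_oneE x : endo_app 1 x = x.
Proof. by []. Qed.
Lemma endo_sumE m (F : 'I_m -> mpoly_endo) x :
  endo_app (\sum_r F r) x = \sum_r endo_app (F r) x.
Proof. by elim/big_ind2: _ => // f y g z <- <-. Qed.

End MpolyEndomorphisms.

Section UniversalProperty.
Variables (K : comNzRingType) (L : lmodType K) (br : L -> L -> L) (B : algType K).
Variable phi : L -> B.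
Hypothesis phi_linear : linear phi.
Hypothesis phi_br : forall x y, phi (br x y) = lie (phi x) (phi y).

Definition word_eval (w : word L) : B := \prod_(x <- (w : seq L)) phi x.

Fact word_eval_mmorphism : mmorphism word_eval.
Proof. by split=> [v w|]; rewrite /word_eval ?big_cat ?big_nil. Qed.
HB.instance Definition _ := isMultiplicative.Build (word L) B word_eval word_eval_mmorphism.

Definition free_eval : free_algebra K L -> B := mmap (in_alg B) word_eval.

Let evalD u v : free_eval (u + v) = free_eval u + free_eval v.
Proof. exact: mmapD. Qed.
Let evalN u : free_eval (- u) = - free_eval u.
Proof. exact: mmapN. Qed.
Let evalZ a u : free_eval (a *: u) = a *: free_eval u.
Proof. by rewrite [LHS]mmapZ /= mulr_algl. Qed.
Let eval1 : free_eval 1 = 1.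
Proof. exact: mmap1. Qed.
Let evalM u v : free_eval (u * v) = free_eval u * free_eval v.
Proof.
apply: (commr_mmap_is_multiplicative _).1 => g m m'.
by rewrite /GRing.comm /= mulr_algl mulr_algr.
Qed.
Let eval_gen x : free_eval (free_gen K x) = phi x.
Proof. by rewrite /free_eval mmapU /= /word_eval big_seq1 scale1r mul1r. Qed.

Let eval_ideal u : ideal (@env_rel K L br) u -> free_eval u = 0.
Proof.
elim=> [|a g b v Gg _ IH]; first exact: mmap0.
rewrite evalD IH addr0 !evalM; case: Gg => [c x y|x y].
  by rewrite evalD evalN evalD evalZ !eval_gen phi_linear subrr mulr0 mul0r.
by rewrite !(evalD, evalN, evalM) !eval_gen phi_br subrr mulr0 mul0r.
Qed.

(** A map compatible with brackets extends to words, and the extension kills the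
    defining relations of the enveloping algebra. *)
Theorem envelop_univ : exists rho : envelop br -> B,
  [/\ linear rho, forall u v, rho (u * v) = rho u * rho v, rho 1 = 1 &
      forall x, rho (env_in br x) = phi x].
Proof.
pose pi := @aq_pi K (free_algebra K L) (ideal_pred (env_rel br)).
pose rep := @aq_repr K (free_algebra K L) (ideal_pred (env_rel br)).
have repK u : pi (rep u) = u by apply: aq_reprK.
have eval_pi u v : pi u = pi v -> free_eval u = free_eval v.
  move=> /aq_piP/asboolP/eval_ideal; rewrite evalD evalN => /eqP.
  by rewrite subr_eq0 => /eqP.
have piP a x y : pi (a *: x + y) = a *: pi x + pi y by rewrite /pi linearP.
have piM x y : pi (x * y) = pi x * pi y by rewrite /pi rmorphM.
have pi1 : pi 1 = 1 by rewrite /pi rmorph1.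
exists (fun u => free_eval (rep u)); split=> [a u v|u v||x].
- rewrite -evalZ -evalD; apply: eval_pi; rewrite repK.
  by have := piP a (rep u) (rep v); rewrite !repK => ->.
- rewrite -evalM; apply: eval_pi; rewrite repK.
  by have := piM (rep u) (rep v); rewrite !repK => ->.
- by rewrite -[RHS]eval1; apply: eval_pi; rewrite repK pi1.
- by rewrite -eval_gen; apply: eval_pi; rewrite repK.
Qed.

End UniversalProperty.

(** * The highest weight module *)

(** The variable of index 0 carries the Verma module of sl2, with lowering operator
    the multiplication by that variable; the others carry the Fock space, with
    e_r a derivation and f_r a multiplication. *)
Section OscillatorModule.
Variables (C : numClosedFieldType) (N : nat).
Local Notation V := {mpoly C[N.+1]}.
Local Notation B := (mpoly_endo C N.+1).

Fact mulX_linear (i : 'I_N.+1) : linear (fun p : V => 'X_i * p).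
Proof. by move=> a p q; rewrite mulrDr -scalerAr. Qed.
Fact der_linear (i : 'I_N.+1) : linear (fun p : V => mderiv i p).
Proof. by move=> a p q; rewrite linearP. Qed.
Definition mulX i : B := endo_of (mulX_linear i).
Definition derX i : B := endo_of (der_linear i).

Lemma lie_der_mul i j : lie (derX i) (mulX j) = (i == j)%:R%:A.
Proof.
apply: endoP => p; rewrite /lie endo_addE endo_oppE !endo_mulE !endo_ofE.
rewrite mderivM addrK mderivX mnm1E.
have [<-|_] := eqVneq j i; last by rewrite !scale0r mul0r.
have -> : (U_(j) - U_(j) = 0)%MM by apply/mnmP => l; rewrite mnmBE subnn mnm0E.
by rewrite mpolyX0 !scale1r mul1r.
Qed.

Lemma lie_der_der i j : lie (derX i) (derX j) = 0.
Proof.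
apply/lie0_intro/endoP => p; rewrite !endo_mulE !endo_ofE; exact: mderiv_comm.
Qed.

Lemma lie_mul_mul i j : lie (mulX i) (mulX j) = 0.
Proof. by apply/lie0_intro/endoP => p; rewrite !endo_mulE !endo_ofE mulrCA. Qed.

Variable lambda : C.
Let y := mulX ord0.
Let d := derX ord0.
Let h := lambda%:A - 2 *: (y * d).
Let x := lambda *: d - y * d * d.
Let f r := mulX (lift ord0 r).
Let e r := derX (lift ord0 r).

Let dy : lie d y = 1. Proof. by rewrite lie_der_mul eqxx scale1r. Qed.
Let yd : lie y d = - 1. Proof. by rewrite lieC dy. Qed.

Let hy : lie h y = - 2 *: y.
Proof.
by rewrite /h !lieE lie_1l lieMl liexx dy mul0r mulr1; lin_ring C.
Qed.
Let xy : lie x y = h.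
Proof.
by rewrite /x !lieE !lieMl liexx dy mul0r add0r !mulr1 /h; lin_ring C.
Qed.
Let hx : lie h x = 2 *: x.
Proof.
rewrite /h /x !lieE !lieMr !lieMl !lie_1l !liexx yd dy.
rewrite !(mul0r, mulr0, addr0, add0r, mulN1r, mulrN, mulr1, mul1r, mulNr).
by rewrite subrr mul0r; lin_ring C.
Qed.

Let comm0 z : lie d z = 0 -> lie y z = 0 -> lie h z = 0 /\ lie x z = 0.
Proof.
move=> dz yz; rewrite /h /x !lieE lie_1l !lieMl dz yz !(mul0r, mulr0, addr0).
by rewrite !scaler0 oppr0 addr0.
Qed.
Let de r : lie d (e r) = 0. Proof. exact: lie_der_der. Qed.
Let df r : lie d (f r) = 0. Proof. by rewrite lie_der_mul scale0r. Qed.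
Let ye r : lie y (e r) = 0. Proof. by rewrite lieC lie_der_mul scale0r oppr0. Qed.
Let yf r : lie y (f r) = 0. Proof. exact: lie_mul_mul. Qed.

Lemma oscillator_tilde_rel : tilde_rel (H_of_nu h e f) (E_of_nu x e) (F_of_nu y f)
  e f (fun r s => (- (2^-1 * (r == s)%:R))%:A).
Proof.
apply: tilde_rel_of_nu => //.
- by move=> r; case: (comm0 (de r) (ye r)).
- by move=> r; case: (comm0 (df r) (yf r)).
- by move=> r; case: (comm0 (de r) (ye r)).
- by move=> r; case: (comm0 (df r) (yf r)).
- by move=> r s; apply: lie_der_der.
- by move=> r s; apply: lie_mul_mul.
- by move=> r s; rewrite lie_der_mul (inj_eq lift_inj).
Qed.

Let der1 i : endo_app (derX i) 1 = 0.
Proof. exact: mderivC. Qed.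

Lemma oscillator_H1 : endo_app (H_of_nu h e f) 1 = (lambda - 2^-1 * N%:R) *: 1.
Proof.
rewrite /H_of_nu /h !(endo_addE, endo_oppE, endo_scaleE, endo_mulE, endo_oneE).
rewrite endo_sumE der1 endo_app0 scaler0 big1 => [|r _]; last first.
  by rewrite endo_mulE der1 endo_app0.
by rewrite scalerBl !subr0.
Qed.

Lemma oscillator_E1 : endo_app (E_nu (E_of_nu x e) e) 1 = 0.
Proof.
rewrite /E_nu /E_of_nu subrK /x !(endo_addE, endo_oppE, endo_scaleE, endo_mulE).
by rewrite der1 endo_app0 scaler0 endo_app0 subrr.
Qed.

Lemma oscillator_e1 r : endo_app (e r) 1 = 0.
Proof. exact: der1. Qed.

End OscillatorModule.

Lemma highest_weight_endos (C : numClosedFieldType) (N : nat) (k : C) :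
  exists (H E F : mpoly_endo C N.+1) e f,
  [/\ tilde_rel H E F e f (fun r s : 'I_N => (- (2^-1 * (r == s)%:R))%:A),
      endo_app H 1 = k *: 1, endo_app (E_nu E e) 1 = 0 &
      forall r, endo_app (e r) 1 = 0].
Proof.
(* H differs from the Cartan element of sl2 by N / 2 on the vacuum *)
pose lambda := k + 2^-1 * N%:R.
do 5!eexists; split; first exact: (oscillator_tilde_rel N lambda).
- by rewrite oscillator_H1 addrK.
- exact: oscillator_E1.
- exact: oscillator_e1.
Qed.

(** Operators satisfying the tilde relations define a representation: the images of
    the original basis are found by inverting the change of basis. *)
Section TildeRepresentation.
Variables (C : numClosedFieldType) (N : nat) (B : algType C).
Variables (H E F : B) (e f : 'I_N -> B) (Z : 'I_N -> 'I_N -> B).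
Hypothesis rel : tilde_rel H E F e f Z.
Hypothesis ZC : forall r s, Z r s = Z s r.
Local Notation br := (@jbracket C N).

Let img (b : jbasis N) : B :=
  match b with
  | BE => (2^-1 * 'i) *: (H - E + F)
  | BF => (- 2^-1 * 'i) *: (H + E - F)
  | BH => E + F
  | Be r => (- 'i) *: (e r - f r)
  | Bf r => e r + f r
  | BZ q => (- 2 * 'i) *: Z (val q).1 (val q).2
  end.

Let phi (x : jacobi C N) : B := \sum_b (x b : C) *: img b.

Let phi_linear : linear phi.
Proof.
move=> a x y; rewrite /phi scaler_sumr -big_split; apply: eq_bigr => b _ /=.
by rewrite !ffunE scalerDl scalerA.
Qed.

Let phiZ a x : phi (a *: x) = a *: phi x.
Proof. by rewrite /phi scaler_sumr; apply: eq_bigr => b _; rewrite ffunE scalerA. Qed.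
Let phiD x y : phi (x + y) = phi x + phi y.
Proof. by have := phi_linear 1 x y; rewrite !scale1r. Qed.
Let phiN x : phi (- x) = - phi x.
Proof. by rewrite -scaleN1r phiZ scaleN1r. Qed.
Let phi0 : phi 0 = 0.
Proof. by rewrite -[0](scale0r (jHt C N)) phiZ scale0r. Qed.

Let phi_vec b : phi (jvec C b) = img b.
Proof.
rewrite /phi (bigD1 b) //= jvecE eqxx scale1r big1 ?addr0 // => c /negPf ncb.
by rewrite jvecE ncb scale0r.
Qed.

Let sqri : 'i ^+ 2 = -1 :> C.
Proof. by rewrite sqrCi. Qed.
Ltac lin_i := linear_over C; do ?[split]; first [done | by field: sqri].

Let phiH : phi (jHt C N) = H.
Proof. by rewrite /jHt /jE /jF phiZ phiD phiN !phi_vec /img; lin_i. Qed.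
Let phiE : phi (jEt C N) = E.
Proof. by rewrite /jEt /jE /jF /jH !(phiZ, phiD) !phi_vec /img; lin_i. Qed.
Let phiF : phi (jFt C N) = F.
Proof. by rewrite /jFt /jE /jF /jH !(phiZ, phiD, phiN) !phi_vec /img; lin_i. Qed.
Let phie r : phi (jet C r) = e r.
Proof. by rewrite /jet /je /jf !(phiZ, phiD) !phi_vec /img; lin_i. Qed.
Let phif r : phi (jft C r) = f r.
Proof. by rewrite /jft /je /jf !(phiZ, phiD, phiN) !phi_vec /img; lin_i. Qed.
Let phiZt r s : phi (jZt C r s) = Z r s.
Proof.
rewrite /jZt phiZ phi_vec /img /= /sort_pair; case: ifP => _ /=; last rewrite ZC; lin_i.
Qed.

(** Compatibility with one bracket; it is symmetric and linear, so that it need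
    only be checked on pairs of tilde vectors. *)
Let R x y : Prop := phi (br x y) = lie (phi x) (phi y).

Let R_sym x y : R x y -> R y x.
Proof. by move=> Rxy; rewrite /R jbracketC phiN Rxy -lieC. Qed.

Let R_lin x a y z : R x y -> R x z -> R x (a *: y + z).
Proof. by rewrite /R jbracketDr jbracketZr !phiD !phiZ lieDr lieZr => -> ->. Qed.

Let R_self x : R x x.
Proof.
rewrite /R liexx.
have : br x x + br x x = 0 by rewrite {1}jbracketC addNr.
rewrite -mulr2n -scaler_nat => /(congr1 (fun u => 2^-1 *: u)).
by rewrite scalerA mulVf ?pnatr_eq0 // scale1r scaler0 => ->.
Qed.

Let R_Z x r s : (forall p q, lie (phi x) (Z p q) = 0) -> R x (jZt C r s).
Proof. by move=> xZ; rewrite /R jbracket_Zt phi0 phiZt xZ. Qed.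

Let RHE : R (jHt C N) (jEt C N). Proof. by rewrite /R jHtEt phiZ phiH phiE (t_HE rel). Qed.
Let RHF : R (jHt C N) (jFt C N). Proof. by rewrite /R jHtFt phiZ phiH phiF (t_HF rel). Qed.
Let RHe r : R (jHt C N) (jet C r). Proof. by rewrite /R jHtet phiH phie (t_He rel). Qed.
Let RHf r : R (jHt C N) (jft C r). Proof. by rewrite /R jHtft phiN phiH phif (t_Hf rel). Qed.
Let REF : R (jEt C N) (jFt C N). Proof. by rewrite /R jEtFt phiE phiF phiH (t_EF rel). Qed.
Let REe r : R (jEt C N) (jet C r). Proof. by rewrite /R jEtet phi0 phiE phie (t_Ee rel). Qed.
Let REf r : R (jEt C N) (jft C r). Proof. by rewrite /R jEtft phiN phiE phie phif (t_Ef rel). Qed.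
Let RFe r : R (jFt C N) (jet C r). Proof. by rewrite /R jFtet phiN phiF phie phif (t_Fe rel). Qed.
Let RFf r : R (jFt C N) (jft C r). Proof. by rewrite /R jFtft phi0 phiF phif (t_Ff rel). Qed.
Let Ree r s : R (jet C r) (jet C s). Proof. by rewrite /R jetet phi0 !phie (t_ee rel). Qed.
Let Rff r s : R (jft C r) (jft C s). Proof. by rewrite /R jftft phi0 !phif (t_ff rel). Qed.
Let Ref r s : R (jet C r) (jft C s). Proof. by rewrite /R jetft phiZ phie phif phiZt (t_ef rel). Qed.

Let phi_br x y : phi (br x y) = lie (phi x) (phi y).
Proof.
apply: (tilde_ind (P := fun y => R x y)) y => [a y z||||r|r|r s]; first exact: R_lin.
all: apply: R_sym.
all: apply: (tilde_ind (P := fun x => R _ x)) x => [a y z||||p|p|p q]; try exact: R_lin.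
- exact: R_self.
- exact: RHE.
- exact: RHF.
- exact: RHe.
- exact: RHf.
- by apply: R_Z => i j; rewrite phiH (t_HZ rel).
- exact: R_sym RHE.
- exact: R_self.
- exact: REF.
- exact: REe.
- exact: REf.
- by apply: R_Z => i j; rewrite phiE (t_EZ rel).
- exact: R_sym RHF.
- exact: R_sym REF.
- exact: R_self.
- exact: RFe.
- exact: RFf.
- by apply: R_Z => i j; rewrite phiF (t_FZ rel).
- exact: R_sym (RHe _).
- exact: R_sym (REe _).
- exact: R_sym (RFe _).
- exact: Ree.
- exact: Ref.
- by apply: R_Z => i j; rewrite phie (t_eZ rel).
- exact: R_sym (RHf _).
- exact: R_sym (REf _).
- exact: R_sym (RFf _).
- exact: R_sym (Ref _ _).
- exact: Rff.
- by apply: R_Z => i j; rewrite phif (t_fZ rel).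
- by apply/R_sym/R_Z => i j; rewrite phiH (t_HZ rel).
- by apply/R_sym/R_Z => i j; rewrite phiE (t_EZ rel).
- by apply/R_sym/R_Z => i j; rewrite phiF (t_FZ rel).
- by apply/R_sym/R_Z => i j; rewrite phie (t_eZ rel).
- by apply/R_sym/R_Z => i j; rewrite phif (t_fZ rel).
- by apply: R_Z => i j; rewrite phiZt (t_ZZ rel).
Qed.

Lemma jU_rep : exists rho : jU C N -> B,
  [/\ linear rho, forall u v, rho (u * v) = rho u * rho v, rho 1 = 1,
      [/\ rho (jin (jHt C N)) = H, rho (jin (jEt C N)) = E & rho (jin (jFt C N)) = F] &
      [/\ forall r, rho (jin (jet C r)) = e r, forall r, rho (jin (jft C r)) = f r &
          forall r s, rho (jin (jZt C r s)) = Z r s]].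
Proof.
have [rho [lin rM r1 rin]] := envelop_univ phi_linear phi_br.
exists rho; split=> //.
  split; [exact: etrans (rin _) phiH|exact: etrans (rin _) phiE|].
  exact: etrans (rin _) phiF.
split=> [r|r|r s]; [exact: etrans (rin _) (phie r)|exact: etrans (rin _) (phif r)|].
exact: etrans (rin _) (phiZt r s).
Qed.

End TildeRepresentation.

(** * From modules to characters *)
Section JacobiCharacters.
Variables (C : numClosedFieldType) (N : nat) (k : C).
Local Notation U := (jU C N).
Local Notation Uk := (jUk C N).
Local Notation D := (jD N k).
Local Notation jin := (@jin C N).
Local Notation H := (jin (jHt C N)).
Local Notation e := (fun r => jin (jet C r)).
Local Notation f := (fun r => jin (jft C r)).
Local Notation J := (ideal_pred (@jJgen C N)).
Local Notation S := (@jZs C N).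
Local Notation E := (jEnu C N).
Local Notation F := (jFnu C N).
Local Notation V := {mpoly C[N.+1]}.

Let pi (x : Uk) : D := jpi k x.

Let piP a x y : pi (a *: x + y) = a *: pi x + pi y.
Proof. by rewrite /pi /jpi linearP. Qed.
Let piM x y : pi (x * y) = pi x * pi y.
Proof. by rewrite /pi /jpi rmorphM. Qed.
Let val_lin a (x y : Uk) : val (a *: x + y) = a *: val x + val y.
Proof. exact: linearP. Qed.
Let pi1 : pi 1 = 1.
Proof. by rewrite /pi /jpi rmorph1. Qed.
Let pi_eq x y : jI k (val x - val y) -> pi x = pi y.
Proof. by move=> Ixy; apply/aq_piP/asboolP; rewrite raddfB. Qed.
Let eq_pi x y : pi x = pi y -> jI k (val x - val y).
Proof. by move=> /aq_piP/asboolP; rewrite raddfB. Qed.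
Let pi_surj d : exists x, d = pi x.
Proof. by exists (aq_repr (d : algquot (jIk k))); rewrite /pi /jpi aq_reprK. Qed.

(** The vector 1 spans a line stable under the elements of weight 0, since these
    are scalars plus elements killing 1; the eigenvalue is the character. *)
Lemma character_of_module (rho : U -> mpoly_endo C N.+1) (L0 : set D) :
  linear rho -> (forall u v, rho (u * v) = rho u * rho v) -> rho 1 = 1 ->
  (forall u, jI k u -> endo_app (rho u) 1 = 0) ->
  (forall d, L0 d -> exists x, d = pi x /\ endo_app (rho (val x)) 1 = 0) ->
  (forall d : D, exists (c : C) (l : D), span L0 l /\ d = c *: (1 : D) + l) ->
  exists chi : D -> C, is_character chi /\ kernel chi = span L0.
Proof.
move=> lin rM r1 rI gens dec.
pose ev u : V := endo_app (rho u) 1.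
have {}gens d : L0 d -> exists x, d = pi x /\ ev (val x) = 0 by exact: gens.
have evP a u v : ev (a *: u + v) = a *: ev u + ev v by rewrite /ev lin.
have ev0 : ev 0 = 0 by apply: rI; apply: LIdeal0.
have evB u v : ev (u - v) = ev u - ev v.
  by rewrite addrC -scaleN1r evP scaleN1r addrC.
have ev1 : ev 1 = 1 by rewrite /ev r1.
have evM c u v : ev v = c *: 1 -> ev (u * v) = c *: ev u.
  by rewrite /ev rM endo_mulE => ->; rewrite endo_appZ.
have ev_pi x y : pi x = pi y -> ev (val x) = ev (val y).
  by move=> /eq_pi/rI; rewrite -/(ev _) evB => /eqP; rewrite subr_eq0 => /eqP.
have inj (a b : C) : a *: (1 : V) = b *: 1 -> a = b.
  move=> /(congr1 (mpoly.mcoeff 0%MM)).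
  by rewrite !mpoly.mcoeffZ mpoly.mcoeff1 eqxx !mulr1.
have evL l : span L0 l -> exists x, l = pi x /\ ev (val x) = 0.
  elim=> [|a g v Lg _ [y [-> ey]]].
    by exists 0; rewrite /pi /jpi !raddf0.
  have [x [-> ex]] := gens g Lg.
  exists (a *: x + y); rewrite piP; split=> //.
  by rewrite val_lin evP ex ey scaler0 addr0.
have ex_chi d : exists c, forall x, d = pi x -> ev (val x) = c *: 1.
  have [c [l [/evL[y [el ey]] ed]]] := dec d.
  exists c => x edx.
  have -> : ev (val x) = ev (val (c *: 1 + y)).
    by apply: ev_pi; rewrite -edx piP pi1 -el.
  by rewrite val_lin evP ey addr0 rmorph1 ev1.
have [chi chiP] := choice ex_chi.
have chi_pi x : ev (val x) = chi (pi x) *: 1 by apply: chiP.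
have chi_lin a d d' : chi (a *: d + d') = a * chi d + chi d'.
  have [x ->] := pi_surj d; have [y ->] := pi_surj d'.
  apply: inj; rewrite -piP -chi_pi val_lin evP !chi_pi.
  by rewrite scalerA scalerDl.
have chiM d d' : chi (d * d') = chi d * chi d'.
  have [x ->] := pi_surj d; have [y ->] := pi_surj d'.
  apply: inj; rewrite -piM -chi_pi rmorphM (evM _ _ _ (chi_pi y)) chi_pi.
  by rewrite scalerA mulrC.
have chi1 : chi 1 = 1.
  by apply: inj; rewrite -pi1 -chi_pi rmorph1 ev1 scale1r.
have chi0L l : span L0 l -> chi l = 0.
  by move=> /evL[x [-> ex]]; apply: inj; rewrite -chi_pi ex scale0r.
exists chi; split.
  split=> [a d d'||c]; [exact: chi_lin|by split|].
  exists (c *: (1 : D) + 0); rewrite chi_lin chi1 mulr1 chi0L ?addr0 //.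
  exact: Span0.
apply/seteqP; split=> [d|l /chi0L] //.
rewrite /kernel /=; have [c [l [Ll ->]]] := dec d.
rewrite chi_lin chi1 mulr1 (chi0L _ Ll) addr0 => ->.
by rewrite scale0r add0r.
Qed.

Lemma jD_decomposition (G : set U) (L0 : set D) :
  (forall x : Uk, exists v, span G v /\ jI k (val x - v)) ->
  (forall g, G g -> exists y : Uk, val y = g /\ (y = 1 \/ L0 (pi y))) ->
  forall d : D, exists (c : C) (l : D), span L0 l /\ d = c *: (1 : D) + l.
Proof.
move=> spanG gensG d.
have [x ->] := pi_surj d; have [v [Gv Iv]] := spanG x.
have [y [ey [c [l [Ll el]]]]] : exists y : Uk, val y = v /\
    exists (c : C) (l : D), span L0 l /\ pi y = c *: (1 : D) + l.
  elim: Gv => [|a g u Gg _ [y [ey [c [l [Ll el]]]]]].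
    exists 0; rewrite raddf0; split=> //; exists 0, 0; split; first exact: Span0.
    by rewrite /pi /jpi raddf0 scale0r addr0.
  have [z [ez]] := gensG g Gg; exists (a *: z + y); rewrite val_lin ez ey; split=> //.
  rewrite piP el; case: b => [->|Lz].
    exists (a + c), l; split=> //; by rewrite pi1 scalerDl addrA.
  exists c, (a *: pi z + l); split; first exact: SpanD.
  by rewrite addrCA.
exists c, l; split=> //; rewrite -el; apply: pi_eq; rewrite ey; exact: Iv.
Qed.

End JacobiCharacters.

(** * The two characters *)
Section TwoCharacters.
Variables (C : numClosedFieldType) (N : nat) (k : C).
Local Notation U := (jU C N).
Local Notation Uk := (jUk C N).
Local Notation D := (jD N k).
Local Notation jin := (@jin C N).
Local Notation H := (jin (jHt C N)).
Local Notation e := (fun r => jin (jet C r)).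
Local Notation f := (fun r => jin (jft C r)).
Local Notation J := (ideal_pred (@jJgen C N)).
Local Notation S := (@jZs C N).
Local Notation E := (jEnu C N).
Local Notation F := (jFnu C N).
Local Notation V := {mpoly C[N.+1]}.
Local Notation B := (mpoly_endo C N.+1).
Local Notation Zs := (fun r s : 'I_N => (- (2^-1 * (r == s)%:R))%:A : B).

Let rel := jU_nu_rel C N.
Let gen := @jU_left_generated C N.

Lemma rep_of_tilde_rel (H' E' F' : B) (e' f' : 'I_N -> B) :
  tilde_rel H' E' F' e' f' Zs -> endo_app H' 1 = k *: 1 ->
  exists rho : U -> B,
  [/\ [/\ linear rho, forall u v, rho (u * v) = rho u * rho v & rho 1 = 1],
      forall u, jI k u -> endo_app (rho u) 1 = 0,
      rho E = E_nu E' e', rho F = F_nu F' f' &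
      (forall r, rho (e r) = e' r) /\ (forall r, rho (f r) = f' r)].
Proof.
move=> rel' H1.
have ZC (r s : 'I_N) : Zs r s = Zs s r by rewrite eq_sym.
have [rho [lin rM r1 [rH rE rF] [re rf rZ]]] := jU_rep rel' ZC.
have rD u v : rho (u + v) = rho u + rho v by have := lin 1 u v; rewrite !scale1r.
have r0 : rho 0 = 0 by apply: (addrI (rho 0)); rewrite -rD !addr0.
have rZ' a u : rho (a *: u) = a *: rho u by have := lin a u 0; rewrite r0 !addr0.
have rN u : rho (- u) = - rho u by rewrite -scaleN1r rZ' scaleN1r.
have rsq (g : 'I_N -> U) g' : (forall r, rho (g r) = g' r) ->
    rho (2^-1 *: \sum_r g r ^+ 2) = 2^-1 *: \sum_r g' r ^+ 2.
  move=> rg; rewrite rZ' (big_morph rho rD r0); congr (_ *: _).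
  by apply: eq_bigr => r _; rewrite !expr2 rM rg.
exists rho; split=> //.
- move=> u; elim=> [|a g x Gg _ IH]; first by rewrite r0.
  rewrite rD endo_addE rM endo_mulE IH addr0.
  suff -> : endo_app (rho g) 1 = 0 by apply: endo_app0.
  case: Gg => [->|[r [s ->]]].
    by rewrite rD rN rZ' r1 rH endo_addE endo_oppE endo_scaleE endo_oneE H1 subrr.
  rewrite rD rZ' r1 rZ endo_addE !endo_scaleE endo_oneE.
  by rewrite scaleNr addNr.
- by rewrite /jEnu /E_nu rD rE (rsq _ _ re).
- by rewrite /jFnu /F_nu rD rN rF (rsq _ _ rf).
Qed.

Lemma lmon_kill (A : pzRingType) n (g : 'I_n -> A) (G : A) (rho : A -> B) a x :
  (forall u v, rho (u * v) = rho u * rho v) ->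
  endo_app (rho G) 1 = 0 -> (forall r, endo_app (rho (g r)) 1 = 0) ->
  (0 < a)%N -> lmon g G a x -> endo_app (rho x) 1 = 0.
Proof.
move=> rM rG rg a0 Lx; have := lmon_last Lx.
case=> [[ea _]|[b [r [y [_ _ ->]]]]|[b [y [_ _ ->]]]]; first by rewrite ea in a0.
  by rewrite rM endo_mulE rg endo_app0.
by rewrite rM endo_mulE rG endo_app0.
Qed.

Lemma jmonE_lmon i I : lmon e E (jweight i I) (jmonE C i I).
Proof. exact: lmon_powmon. Qed.
Lemma jmonF_lmon i I : lmon f F (jweight i I) (jmonF C i I).
Proof. exact: lmon_powmon. Qed.

Lemma lmon_jmonE a x : lmon e E a x -> exists i I, jweight i I = a /\ x = jmonE C i I.
Proof. by move=> /(lmonP (nu_ee rel) (nu_Ee rel)). Qed.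
Lemma lmon_jmonF a x : lmon f F a x -> exists i I, jweight i I = a /\ x = jmonF C i I.
Proof. by move=> /(lmonP (nu_ff rel) (nu_Ff rel)). Qed.

Lemma lmon0 (A : pzRingType) n (g : 'I_n -> A) (G : A) x : lmon g G 0 x -> x = 1.
Proof. by move=> /lmon_last[[_ ->]|[? [? [? []]]]|[? [? []]]]. Qed.

Lemma jLf_decomposition d : exists (c : C) (l : D), jLf N k l /\ d = c *: (1 : D) + l.
Proof.
apply: (jD_decomposition (G := weight_mon E F e f 0)) d => [x|g].
  have [v [Vv Iv]] := weight_span k rel gen (jUk_wt x).
  by exists v; split=> //; apply/jI_kideal.
move=> [a [b [u [v [/eqP eab Lu Lv ->]]]]].
move: eab; rewrite eq_sym subr_eq0 eqr_nat => /eqP eba; rewrite {}eba in Lv.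
case: a Lu Lv => [|a] Lu Lv.
  by exists 1; rewrite (lmon0 Lu) (lmon0 Lv) mulr1; split; [rewrite rmorph1|left].
have [iF [If [wF eu]]] := lmon_jmonF Lu; have [iE [Ie [wE ev]]] := lmon_jmonE Lv.
have w : jweight iF If = jweight iE Ie by rewrite wF wE.
exists (jmonFE C w); rewrite eu ev; split=> //; right.
by exists iF, iE, If, Ie, w; rewrite wF.
Qed.

Lemma jLe_decomposition d : exists (c : C) (l : D), jLe N k l /\ d = c *: (1 : D) + l.
Proof.
apply: (jD_decomposition (G := weight_mon F E f e 0)) d => [x|g].
  have [v [Vv Iv]] := weight_span (- k) (nu_rel_swap rel) (left_generated_swap gen)
    (weight0Nl (jUk_wt x)).
  by exists v; split=> //; apply/jI_kideal; have := kidealN Iv; rewrite !opprK.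
move=> [a [b [u [v [/eqP eab Lu Lv ->]]]]].
move: eab; rewrite eq_sym subr_eq0 eqr_nat => /eqP eba; rewrite {}eba in Lv.
case: a Lu Lv => [|a] Lu Lv.
  by exists 1; rewrite (lmon0 Lu) (lmon0 Lv) mulr1; split; [rewrite rmorph1|left].
have [iE [Ie [wE eu]]] := lmon_jmonE Lu; have [iF [If [wF ev]]] := lmon_jmonF Lv.
have w : jweight iF If = jweight iE Ie by rewrite wF wE.
exists (jmonEF C w); rewrite eu ev; split=> //; right.
by exists iF, iE, If, Ie, w; rewrite wF.
Qed.

Lemma chi_f_exists : exists chi : D -> C, is_character chi /\ kernel chi = jLf N k.
Proof.
have [H' [E' [F' [e' [f' [rel' H1 E1 e1]]]]]] := highest_weight_endos N k.
have [rho [[lin rM r1] rI rE _ [re _]]] := rep_of_tilde_rel rel' H1.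
apply: (character_of_module lin rM r1 rI); last exact: jLf_decomposition.
move=> d [iF [iE [If [Ie [w [w0 ->]]]]]]; exists (jmonFE C w); split=> //.
have E0 : endo_app (rho E) 1 = 0 by rewrite rE.
have e0 r : endo_app (rho (e r)) 1 = 0 by rewrite re.
rewrite rM endo_mulE (lmon_kill rM E0 e0 _ (jmonE_lmon iE Ie)) -?w //.
exact: endo_app0.
Qed.

(** The flipped module has 1 as a lowest weight vector: E_nu becomes - F_nu.  Its
    eigenvalue changes sign with H, whence the weight - k. *)
Lemma chi_e_exists : exists chi : D -> C, is_character chi /\ kernel chi = jLe N k.
Proof.
have [H' [E' [F' [e' [f' [rel' H1 E1 e1]]]]]] := highest_weight_endos N (- k).
have Hk : endo_app (- H') 1 = k *: 1 by rewrite endo_oppE H1 scaleNr opprK.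
have rel2 : tilde_rel (- H') (- F') (- E') f' (fun r => - e' r) Zs.
  have eZ : (fun r s => Zs s r) = Zs.
    by apply/funext => r; apply/funext => s; rewrite eq_sym.
  by rewrite -eZ; apply: tilde_rel_flip rel'.
have [rho [[lin rM r1] rI _ rF [_ rf]]] := rep_of_tilde_rel rel2 Hk.
apply: (character_of_module lin rM r1 rI); last exact: jLe_decomposition.
move=> d [iF [iE [If [Ie [w [w0 ->]]]]]]; exists (jmonEF C w); split=> //.
have F0 : endo_app (rho F) 1 = 0.
  have -> : rho F = - E_nu E' e'.
    rewrite rF /F_nu /E_nu opprD; congr (_ - _ *: _).
    by apply: eq_bigr => r _; rewrite sqrrN.
  by rewrite endo_oppE E1 oppr0.
have f0 r : endo_app (rho (f r)) 1 = 0 by rewrite rf endo_oppE e1 oppr0.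
rewrite rM endo_mulE (lmon_kill rM F0 f0 _ (jmonF_lmon iF If)) //.
exact: endo_app0.
Qed.

Section Uniqueness.
Variable chi : D -> C.
Hypothesis chi_char : is_character chi.

(** Elements outside the commutant are sent to chi(1). *)
Definition pull (u : U) : C := chi (jpi k (insubd (1 : Uk) u)).

Let insubK u : weight H S 0 u -> val (insubd (1 : Uk) u) = u.
Proof. by move=> wu; apply: insubdK; apply: (jwt_commutant wu). Qed.

Lemma pull_val (x : Uk) : pull (val x) = chi (jpi k x).
Proof. by rewrite /pull valKd. Qed.

Lemma pull_character : wt0_character J S H k pull.
Proof.
have [lin [chi1 chiM] _] := chi_char.
have wt1 : weight H S 0 1 by apply: weight1.
split=> [a u v wu wv|u v wu wv||u wu Iu].
- rewrite -[in LHS](insubK wu) -[in LHS](insubK wv).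
  have -> : a *: val (insubd (1 : Uk) u) + val (insubd (1 : Uk) v) =
    val (a *: insubd (1 : Uk) u + insubd (1 : Uk) v) by rewrite linearP.
  rewrite pull_val /jpi linearP; exact: lin.
- rewrite -[in LHS](insubK wu) -[in LHS](insubK wv) -rmorphM pull_val /jpi rmorphM.
  exact: chiM.
- have -> : pull 1 = pull (val (1 : Uk)) by rewrite rmorph1.
  by rewrite pull_val /jpi rmorph1.
- rewrite -(insubK wu) pull_val.
  have -> : jpi k (insubd (1 : Uk) u) = 0.
    have e0 : jpi k (0 : Uk) = 0 by rewrite /jpi raddf0.
    rewrite -e0; apply/aq_piP/asboolP; rewrite subr0 (insubK wu); exact/jI_kideal.
  by have := lin (- 1) 0 0; rewrite scaler0 addr0 => ->; rewrite scaleN1r addNr.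
Qed.

(** Two characters killing a common complement of the scalars agree. *)
Lemma character_ker L : (forall d, exists (c : C) (l : D), L l /\ d = c *: (1 : D) + l) ->
  L `<=` kernel chi -> forall chi' : D -> C, is_character chi' -> kernel chi' = L ->
  chi = chi'.
Proof.
move=> dec Lchi chi' [lin' [chi1' _] _] ker'; have [lin [chi1 _] _] := chi_char.
apply/funext => d; have [c [l [Ll ->]]] := dec d.
have cl : chi l = 0 by apply: Lchi.
have cl' : chi' l = 0 by move: Ll; rewrite -ker'.
apply: (etrans (lin c 1 l)); apply/esym/(etrans (lin' c 1 l)).
by rewrite cl cl' chi1 chi1'.
Qed.

Lemma kernel_span L0 : L0 `<=` kernel chi -> span L0 `<=` kernel chi.
Proof.
move=> L0chi l; have [lin _ _] := chi_char.
elim=> [|a g v Lg _ IH]; rewrite /kernel /=.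
  by have := lin (- 1) 0 0; rewrite scaler0 addr0 => ->; rewrite scaleN1r addNr.
by rewrite lin IH (L0chi g Lg) scaler0 addr0.
Qed.

Lemma character_dichotomy : (1 < N)%N ->
  jLf N k `<=` kernel chi \/ jLe N k `<=` kernel chi.
Proof.
move=> N1; pose r0 : 'I_N := Ordinal (ltnW N1).
have chr := pull_character.
have n1 : (1 : C) != 0 by apply: oner_neq0.
have [fe0|ef0] := chi_fe_dichotomy rel chr N1 n1.
- left; apply: kernel_span => d [iF [iE [If [Ie [w [w0 ->]]]]]].
  rewrite /kernel /= -pull_val.
  apply: (chi_low_up rel chr n1 fe0 r0 gen w0 (jmonF_lmon iF If)).
  by rewrite w; apply: jmonE_lmon.
- right; apply: kernel_span => d [iF [iE [If [Ie [w [w0 ->]]]]]].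
  rewrite /kernel /= -pull_val.
  have nN1 : - 1 != 0 :> C by rewrite oppr_eq0.
  apply: (chi_low_up (nu_rel_swap rel) (wt0_characterN chr) nN1 (fun r s => ef0 s r) r0
    (left_generated_swap gen) w0 _ (jmonF_lmon iF If)).
  by rewrite w; apply: jmonE_lmon.
Qed.

End Uniqueness.

Theorem two_characters : (1 < N)%N ->
  exists chi_f chi_e : D -> C,
    [/\ is_character chi_f /\ kernel chi_f = jLf N k,
        is_character chi_e /\ kernel chi_e = jLe N k &
        forall chi : D -> C, is_character chi -> chi = chi_f \/ chi = chi_e].
Proof.
move=> N1.
have [chi_f [f_char f_ker]] := chi_f_exists.
have [chi_e [e_char e_ker]] := chi_e_exists.
exists chi_f, chi_e; split=> // chi chi_char.
have [Lf|Le] := character_dichotomy chi_char N1; [left|right].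
  exact: (character_ker chi_char jLf_decomposition Lf).
exact: (character_ker chi_char jLe_decomposition Le).
Qed.

End TwoCharacters.

Theorem theorem5p4 (R : realType) (N : nat) (k : R[i]) :
  (1 < N)%N ->
  exists chi_f chi_e : jD N k -> R[i],
    [/\ is_character chi_f /\ kernel chi_f = jLf N k,
        is_character chi_e /\ kernel chi_e = jLe N k &
        forall chi : jD N k -> R[i],
          is_character chi -> chi = chi_f \/ chi = chi_e].
Proof. exact: two_characters. Qed.
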